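(* Let $\vec u(t)=(u,u_t)$ be a smooth finite energy radial solution to $$u_{tt}-u_{rr}-\tfrac{3}{r}u_r-u^3=0$$ which is defined for all $t\in[0,+\infty)$ and satisfies $\sup_{t\in[0,+\infty)}\|\vec u(t)\|_{\mathcal{H}}<\infty$. Let $\lambda\in(0,1)$. Then $$\limsup_{t\to+\infty}\int_{\lambda t}^{t-R}\left(|\nabla_{t,r}u(t,r)|^2+\frac{|u(t,r)|^2}{r^2}\right)r^3\,dr\to0\quad\text{as } R\to+\infty .$$
   Context: All functions of $x\in\mathbb{R}^4$ are real-valued and radial, written $f(x)=f(r)$, $r=|x|$. $\mathcal{H}=\dot H^1\times L^2(\mathbb{R}^4)$ (radial), with $\|(f,g)\|_{\mathcal{H}}^2=\int_0^\infty(f_r^2+g^2)\,r^3dr$ (dimensional constants are dropped). For every data in $\mathcal{H}$ the equation has a unique solution $\vec u=(u,u_t)\in C(I_{\max};\mathcal{H})$ with $u\in L^3_t(J;L^6_x(\mathbb{R}^4))$ for every compact $J\subset I_{\max}$, on a maximal interval $I_{\max}$. Notation: $|\nabla_{t,r}u|^2=u_t^2+u_r^2$. *)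

(* Defs.v *)
From HB Require Import structures.
From mathcomp Require Export all_boot all_order all_algebra.
From mathcomp Require Export all_classical all_reals all_analysis.

Set Implicit Arguments.
Unset Strict Implicit.
Unset Printing Implicit Defensive.

Export Order.TTheory GRing.Theory Num.Theory.
Export numFieldNormedType.Exports.

Global Open Scope classical_set_scope.
Global Open Scope ring_scope.

(* The library norm on 'rV[R]_n is the sup norm, hence this definition. *)
Definition euclid_norm (R : realType) (n : nat) (x : 'rV[R]_n) : R :=
  Num.sqrt (\sum_(i < n) x ord0 i ^+ 2).

(* C^n on the open set O of a finite-dimensional space V: derivatives of order
   up to n in arbitrary directions exist and are continuous on O. *)
Fixpoint C_on (R : realType) (V : normedModType R) (n : nat) (O : set V)
    (f : V -> R) : Prop :=
  (forall z, O z -> {for z, continuous f}) /\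
  match n with
  | 0 => True
  | m.+1 => forall v : V, (forall z, O z -> derivable (f : V -> R^o) z v) /\
              C_on m O (fun z => derive (f : V -> R^o) z v)
  end.

(* For A not open, f is smooth up to the boundary of A: the values of the total
   function f outside A play the role of a smooth extension of f restricted
   to A. *)
Definition smooth_on (R : realType) (V : normedModType R) (A : set V)
    (f : V -> R) : Prop :=
  exists O : set V, [/\ open O, A `<=` O & forall n, C_on n O f].

(* A radial function of (t, x) in R x R^4 is represented by its profile
   u : R -> R -> R in the variables (t, r); only r >= 0 is meaningful. *)
Definition radial_lift (R : realType) (u : R -> R -> R)
    (z : (R^o * 'rV[R]_4)%type) : R :=
  u z.1 (euclid_norm z.2).

Definition dt (R : realType) (u : R -> R -> R) (t r : R) : R := derive1 (u ^~ r) t.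
Definition dr (R : realType) (u : R -> R -> R) (t r : R) : R := derive1 (u t) r.

(* The integral over R^4 of a radial function, up to the constant |S^3|. *)
Definition radial_int (R : realType) (f : R -> R) : \bar R :=
  (\int[lebesgue_measure]_(r in `]0%R, +oo[) (f r * r ^+ 3)%:E)%E.

Definition Hnorm (R : realType) (f g : R -> R) : \bar R :=
  poweR (radial_int (fun r => derive1 f r ^+ 2 + g r ^+ 2)) (2^-1).

(* Membership of (f, g) in \dot H^1 x L^2(R^4) for smooth f and g. As usual
   \dot H^1(R^4) is realized inside L^4(R^4), 4 being the Sobolev exponent; this
   rules out the nonzero constants, whose gradient vanishes. *)
Definition in_H (R : realType) (f g : R -> R) : Prop :=
  (Hnorm f g < +oo)%E /\ (radial_int (fun r => (`|f r| ^+ 4)%R) < +oo)%E.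

Definition L3L6norm (R : realType) (J : set R) (u : R -> R -> R) : \bar R :=
  poweR (\int[lebesgue_measure]_(t in J)
           poweR (poweR (radial_int (fun r => (`|u t r| ^+ 6)%R)) (6^-1)%R) 3%R)%E
        (3^-1).

Record smooth_finite_energy_solution (R : realType) (I : set R)
    (u : R -> R -> R) : Prop := {
  sol_smooth : smooth_on [set z : (R^o * 'rV[R]_4)%type | I z.1] (radial_lift u);
  sol_eq : forall t r, I t -> 0 < r ->
    dt (dt u) t r - dr (dr u) t r - 3 / r * dr u t r - u t r ^+ 3 = 0;
  sol_H : forall t, I t -> in_H (u t) (dt u t);
  sol_cont : forall t0, I t0 ->
    (fun t => Hnorm (fun r => u t r - u t0 r) (fun r => dt u t r - dt u t0 r))
      @ within I (nbhs t0) --> 0%E;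
  sol_L3L6 : forall J : set R, compact J -> J `<=` I -> (L3L6norm J u < +oo)%E }.

(* The integral of (|grad_{t,r} u|^2 + |u|^2 / r^2) r^3 over [a, b] at time t;
   it is 0 when b < a. *)
Definition local_energy (R : realType) (u : R -> R -> R) (t a b : R) : \bar R :=
  (\int[lebesgue_measure]_(r in `[a, b])
     ((dt u t r ^+ 2 + dr u t r ^+ 2 + `|u t r| ^+ 2 / r ^+ 2) * r ^+ 3)%:E)%E.

(* Main.v *)
(* Idea. The function psi = r u solves
     psi_tt - psi_rr - psi_r / r + (psi - psi^3) / r^2 = 0,
   whose potential energy psi^2 / 2 - psi^4 / 4 is coercive where |psi| <= 1.
   Let J (u, v) be the energy inside the ball of radius r = (v - u) / 2 at time
   t = (u + v) / 2. By conservation of energy, J_v and - J_u are energy fluxes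
   through light cones, both nonnegative where |psi| <= 1, and the equation gives
     |J_uv| <= (2 / r) (s J_v - J_u / s)   for every s > 0.
   For fixed u, J (u, v) increases as v tends to infinity to a limit that
   decreases in u, hence is within e of its infimum g once u is large. The
   differential inequality propagates "g - J is small" from u1 to u2 > u1 at the
   same v if u2 - u1 is a small multiple of v - u2, because the product of g - J
   with a suitable weight has a mixed derivative of constant sign. Smallness of
   g - J on a region in turn makes psi small there, and slightly further inside
   since psi is Hoelder continuous in log r; the starting region is the
   neighbourhood of the light cone, where psi is small by finite speed of
   propagation. After finitely many steps, g - J is
   small on lambda t <= r <= t - R, which bounds the local energy. *)
Require Import Defs.
From mathcomp Require Import measurable_realfun ring lra.

Set Implicit Arguments.
Unset Strict Implicit.
Unset Printing Implicit Defensive.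

(** * One-variable calculus *)

Section Derivatives.
Context {R : realType}.
Implicit Types (f g : R -> R) (a b c x : R).

(* Unlike [is_derive], not a type class, so that derivatives are left to the
   tactic [der] below. *)
Definition has_der (f : R -> R) (x d : R) : Prop := is_derive x 1 f d.

Lemma der_cst c x : has_der (fun=> c : R) x 0.
Proof. exact: is_derive_cst. Qed.

Lemma der_id x : has_der (fun y : R => y) x 1.
Proof. exact: is_derive_id. Qed.

Lemma derD f g x df dg : has_der f x df -> has_der g x dg ->
  has_der (fun y => f y + g y) x (df + dg).
Proof. exact: is_deriveD. Qed.

Lemma derB f g x df dg : has_der f x df -> has_der g x dg ->
  has_der (fun y => f y - g y) x (df - dg).
Proof. exact: is_deriveB. Qed.

Lemma derN f x df : has_der f x df -> has_der (fun y => - f y) x (- df).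
Proof. exact: is_deriveN. Qed.

Lemma derM f g x df dg : has_der f x df -> has_der g x dg ->
  has_der (fun y => f y * g y) x (f x * dg + g x * df).
Proof. exact: is_deriveM. Qed.

Lemma derX f n x df : has_der f x df ->
  has_der (fun y => f y ^+ n) x (n%:R * f x ^+ n.-1 * df).
Proof.
move=> fdf; have -> : (fun y => f y ^+ n) = f ^+ n by rewrite exprfctE.
exact: is_deriveX.
Qed.

Lemma derV f x df : f x != 0 -> has_der f x df ->
  has_der (fun y => (f y)^-1) x (- (f x) ^- 2 * df).
Proof.
move=> fx0 [fd <-]; apply: DeriveDef; first exact: derivableV.
by rewrite deriveV.
Qed.

Lemma der_eq f x d d' : has_der f x d -> d = d' -> has_der f x d'.
Proof. by move=> ? <-. Qed.

End Derivatives.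

(** The clauses for [GRing.mul ?c] and [GRing.add ?c] catch functions such as [fun y => c * y] in
    eta-reduced form. *)
Ltac der_step :=
  match goal with
  | |- has_der (fun _ => ?c) _ _ => apply der_cst
  | |- has_der (GRing.mul ?c) ?x _ => eapply (derM (der_cst c x) (der_id x))
  | |- has_der (GRing.add ?c) ?x _ => eapply (derD (der_cst c x) (der_id x))
  | |- has_der (fun y => y) _ _ => apply der_id
  | |- has_der (fun y => _ + - _) _ _ => eapply derB
  | |- has_der (fun y => _ + _) _ _ => eapply derD
  | |- has_der (fun y => - _) _ _ => eapply derN
  | |- has_der (fun y => _ * _) _ _ => eapply derM
  | |- has_der (fun y => _ ^+ _) _ _ => eapply derX
  | |- has_der (fun y => _ ^-1) _ _ => eapply derV
  end.

Ltac der := eapply der_eq;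
  [repeat first [eassumption | der_step] | cbn beta].

Section Calculus.
Context {R : realType}.
Implicit Types (f g : R -> R) (a b c x : R).

Lemma der_cont f x df : has_der f x df -> {for x, continuous f}.
Proof. by move=> fdf; apply/differentiable_continuous/derivable1_diffP; case: fdf. Qed.

Lemma MVT_cc f df a b : a <= b ->
  (forall x, a <= x <= b -> has_der f x (df x)) ->
  exists2 c, a <= c <= b & f b - f a = df c * (b - a).
Proof.
move=> ab fdf.
have [x xab||c cab ->] := @MVT_segment R f df a b ab.
- by apply: fdf; rewrite !ltW ?(itvP xab).
- apply: derivable_within_continuous => x xab.
  by have := fdf x; rewrite !(itvP xab) => /(_ isT)[].
- by exists c => //; rewrite !(itvP cab).
Qed.

(** The mean value theorem for [g - f]. Its intermediate point is interior, so derivatives are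
    compared in the open interval only; the wave equation and several bounds on [psi] are available
    just there. *)
Lemma der_le f g df dg a b : a <= b ->
  (forall x, a <= x <= b -> has_der f x (df x)) ->
  (forall x, a <= x <= b -> has_der g x (dg x)) ->
  (forall x, a < x < b -> df x <= dg x) ->
  f b - f a <= g b - g a.
Proof.
rewrite le_eqVlt => /predU1P[->|ab fdf gdg le]; first by rewrite !subrr.
have h x : a <= x <= b -> has_der (fun y => g y - f y) x (dg x - df x).
  by move=> xab; apply: derB; [exact: gdg|exact: fdf].
have [x|x|c] := @MVT R (fun y => g y - f y) (fun x => dg x - df x) a b ab.
- by move=> xab; apply/h; rewrite !ltW ?(itvP xab).
- apply: derivable_within_continuous => {}x xab.
  by have := h x; rewrite !(itvP xab) => /(_ isT)[].
move=> cab E; have : 0 <= (dg c - df c) * (b - a).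
  by rewrite mulr_ge0 ?subr_ge0 ?(ltW ab)// le// !(itvP cab).
by rewrite -E; lra.
Qed.

Lemma der_ge0 f df a b : a <= b ->
  (forall x, a <= x <= b -> has_der f x (df x)) ->
  (forall x, a < x < b -> 0 <= df x) -> f a <= f b.
Proof.
move=> ab fdf ge; rewrite -subr_ge0 -(subrr (0 : R)).
by apply: (@der_le (fun=> 0) f (fun=> 0) df) => // x _; exact: der_cst.
Qed.

(** The mean value theorem in [u], then in [v]. *)
Lemma second_difference (W Wu Wuv : R -> R -> R) (u1 u2 v1 v2 : R) :
  u1 <= u2 -> v1 <= v2 ->
  (forall u v, u1 <= u <= u2 -> v1 <= v <= v2 -> has_der (W ^~ v) u (Wu u v)) ->
  (forall u v, u1 <= u <= u2 -> v1 <= v <= v2 -> has_der (Wu u) v (Wuv u v)) ->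
  exists u v, [/\ u1 <= u <= u2, v1 <= v <= v2 &
    W u2 v2 - W u2 v1 - (W u1 v2 - W u1 v1) = Wuv u v * (v2 - v1) * (u2 - u1)].
Proof.
move=> u12 v12 dW dWu.
have v1v : v1 <= v1 <= v2 by rewrite lexx.
have v2v : v1 <= v2 <= v2 by rewrite lexx v12.
have [u|u uin E] := @MVT_cc (fun u => W u v2 - W u v1) (fun u => Wu u v2 - Wu u v1) _ _ u12.
  by move=> uin; apply: derB; exact: dW.
have [v|v vin E'] := @MVT_cc (Wu u) (Wuv u) _ _ v12.
  by move=> vin; exact: dWu.
by exists u, v; split; rewrite // E E'.
Qed.

Lemma rectangle_le0 (W Wu Wuv : R -> R -> R) (u1 u2 v1 v2 : R) :
  u1 <= u2 -> v1 <= v2 ->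
  (forall u v, u1 <= u <= u2 -> v1 <= v <= v2 -> has_der (W ^~ v) u (Wu u v)) ->
  (forall u v, u1 <= u <= u2 -> v1 <= v <= v2 -> has_der (Wu u) v (Wuv u v)) ->
  (forall u v, u1 <= u <= u2 -> v1 <= v <= v2 -> Wuv u v <= 0) ->
  W u2 v2 - W u2 v1 <= W u1 v2 - W u1 v1.
Proof.
move=> u12 v12 dW dWu le0; rewrite -subr_le0.
have [u [v [uI vI ->]]] := second_difference u12 v12 dW dWu.
by rewrite mulr_le0_ge0 ?subr_ge0// mulr_le0_ge0 ?subr_ge0// le0.
Qed.

(* The base point -1 makes the primitive differentiable at the origin. *)
Definition prim (f : R -> R) (x : R) : R :=
  (\int[lebesgue_measure]_(s in `[-1, x]) f s -
   \int[lebesgue_measure]_(s in `[-1, 0]) f s)%R.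

Lemma prim0 f : prim f 0 = 0.
Proof. by rewrite /prim subrr. Qed.

Lemma cont_integrable f a b : continuous f ->
  lebesgue_measure.-integrable `[a, b] (EFin \o f).
Proof.
move=> cf; apply: continuous_compact_integrable; first exact: segment_compact.
exact: continuous_subspaceT.
Qed.

Lemma der_prim f x : continuous f -> -1 < x -> has_der (prim f) x (f x).
Proof.
move=> cf x1; have [//|dF F'] := @continuous_FTC1_closed R f (-1) x (x + 1) _ (cont_integrable _ _ cf) x1 (cf x).
  by rewrite ltrDl.
rewrite -[f x]subr0; apply: derB; last exact: der_cst.
by split; [exact: dF|rewrite -derive1E; exact: F'].
Qed.

End Calculus.

(** * Functions of time and radius *)

Section TwoVariables.
Context {R : realType}.
Implicit Types (f g : R -> R -> R) (t r : R).

Lemma has_derP (f : R -> R) x l :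
  (forall e, 0 < e -> exists2 d, 0 < d &
    forall h, `|h| < d -> `|f (x + h) - f x - h * l| <= e * `|h|) ->
  has_der f x l.
Proof.
move=> H.
have cv : h^-1 *: (f (h *: 1 + x) - f x) @[h --> 0^'] --> l.
  apply/cvgrPdist_le => e e0; have [d d0 Hd] := H e e0.
  near=> h.
  have h0 : h != 0 by near: h; exact: nbhs_dnbhs_neq.
  have hd : `|h| < d.
    near: h; apply: dnbhs0_lt => //.
  have -> : l - h^-1 *: (f (h *: 1 + x) - f x) = - h^-1 * (f (x + h) - f x - h * l).
    have -> : h *: 1 + x = x + h by rewrite [_ *: _]mulr1 addrC.
    by rewrite /GRing.scale/=; field.
  rewrite normrM normrN normfV ler_pdivrMl ?normr_gt0// [leRHS]mulrC.
  exact: Hd.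
apply: DeriveDef; first by apply/cvg_ex; exists l.
exact: cvg_lim.
Unshelve. all: by end_near. Qed.

Lemma MVT_any (f df : R -> R) a b :
  (forall x, `|x - a| <= `|b - a| -> has_der f x (df x)) ->
  exists2 c, `|c - a| <= `|b - a| & f b - f a = df c * (b - a).
Proof.
move=> H; have [ab|/ltW ba] := leP a b.
  have [x /andP[ax xb]|c /andP[ac cb] E] := @MVT_cc _ f df _ _ ab.
    by apply: H; rewrite !ger0_norm ?subr_ge0// lerD2r.
  by exists c => //; rewrite !ger0_norm ?subr_ge0// lerD2r.
have [x /andP[ax xb]|c /andP[ac cb] E] := @MVT_cc _ f df _ _ ba.
  by apply: H; rewrite !ler0_norm ?subr_le0// lerN2 lerD2r.
exists c; first by rewrite !ler0_norm ?subr_le0// lerN2 lerD2r.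
by rewrite -opprB E -mulrN opprB.
Qed.

Definition ccont f := forall t r, 0 < t ->
  {for (t, r), continuous (fun z : R * R => f z.1 z.2)}.

Lemma ccontP f t r e : ccont f -> 0 < t -> 0 < e -> exists2 d, 0 < d &
  forall t' r', `|t' - t| < d -> `|r' - r| < d -> `|f t' r' - f t r| < e.
Proof.
move=> cf t0 e0; have /cvgrPdist_lt/(_ e e0)[/= [A B] /= [[d1 /= d10 A1] [d2 /= d20 B1]] AB] := cf t r t0.
exists (Num.min d1 d2); first by rewrite lt_min d10.
move=> t' r'; rewrite !lt_min => /andP[t1 _] /andP[_ r2].
rewrite distrC; apply: (AB (t', r')); split => /=.
  by apply: A1; rewrite /ball_ /= distrC.
by apply: B1; rewrite /ball_ /= distrC.
Qed.

(** A value above [d] at time [t] would persist shortly before [t]. This serves at the first time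
    when a bound fails. *)
Lemma ccont_norm_le_left f (s t r d : R) : ccont f -> 0 < t -> s < t ->
  (forall t', s <= t' -> t' < t -> `|f t' r| < d) -> `|f t r| <= d.
Proof.
move=> cf t0 st H; rewrite leNgt; apply/negP => dx.
have e0 : 0 < `|f t r| - d by rewrite subr_gt0.
have [del del0 Hdel] := ccontP r cf t0 e0.
have m0 : 0 < Num.min del (t - s) by rewrite lt_min del0 subr_gt0.
have m1 : Num.min del (t - s) <= del by rewrite ge_min lexx.
have m2 : Num.min del (t - s) <= t - s by rewrite ge_min lexx orbT.
pose t' := t - Num.min del (t - s) / 2.
have H1 : `|f t' r - f t r| < `|f t r| - d.
  apply: Hdel; last by rewrite subrr normr0.
  by rewrite /t' addrC addKr normrN gtr0_norm; lra.
have H2 : `|f t' r| < d by apply: H; rewrite /t'; lra.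
have := ler_normB (f t' r) (f t' r - f t r).
by rewrite opprB addrC subrK; lra.
Qed.

Lemma ccont_slice f t : ccont f -> 0 < t -> continuous (f t).
Proof.
move=> cf t0 r; apply/cvgrPdist_lt => e e0.
have [d d0 H] := ccontP r cf t0 e0.
exists d => //= r' rr; rewrite distrC; apply: H => /=; first by rewrite subrr normr0.
by rewrite distrC; exact: rr.
Qed.

Lemma ccont_cst (c : R) : ccont (fun _ _ => c).
Proof. by move=> t r _; exact: cst_continuous. Qed.

Lemma ccont_r : ccont (fun _ r => r).
Proof. by move=> t r _; exact: cvg_snd. Qed.

Lemma ccontD f g : ccont f -> ccont g -> ccont (fun t r => f t r + g t r).
Proof. by move=> cf cg t r t0; exact: (continuousD (cf t r t0) (cg t r t0)). Qed.

Lemma ccontN f : ccont f -> ccont (fun t r => - f t r).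
Proof. by move=> cf t r t0; exact: (continuousN (cf t r t0)). Qed.

Lemma ccontM f g : ccont f -> ccont g -> ccont (fun t r => f t r * g t r).
Proof. by move=> cf cg t r t0; exact: (continuousM (cf t r t0) (cg t r t0)). Qed.

Lemma ccontX f n : ccont f -> ccont (fun t r => f t r ^+ n).
Proof.
move=> cf t r t0.
exact: (continuous_comp (cf t r t0) (@exprn_continuous R n (f t r))).
Qed.

Lemma ccont_bounded f (t1 t2 a b : R) : ccont f -> 0 < t1 ->
  exists2 M, 0 <= M & forall t r, t1 <= t <= t2 -> a <= r <= b -> `|f t r| <= M.
Proof.
move=> cf t10; pose K := `[t1, t2] `*` `[a, b] : set (R * R).
have cK : compact K by apply: compact_setX; exact: segment_compact.
have cfK : {within K, continuous (fun z : R * R => f z.1 z.2)}.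
  apply: continuous_in_subspaceT => -[t r]; rewrite inE => -[/=].
  rewrite in_itv/= => /andP[tt _] _; apply: cf; exact: lt_le_trans tt.
have /compact_bounded := continuous_compact cfK cK.
move=> [M [_ HM]]; exists (`|M| + 1); first by rewrite addr_ge0.
move=> t r tI rI; apply: (HM (`|M| + 1)).
  by rewrite (le_lt_trans (ler_norm _))// ltrDl.
by exists (t, r) => //; split; rewrite /= in_itv.
Qed.

Record C1 (f ft fr : R -> R -> R) : Prop := {
  C1_t : forall t r, 0 < t -> has_der (f ^~ r) t (ft t r) ;
  C1_r : forall t r, 0 < t -> has_der (f t) r (fr t r) ;
  C1_ct : ccont ft ;
  C1_cr : ccont fr }.

(** The chain rule along a line: an increment is split into a step in time and a step in radius,
    each treated by the mean value theorem. The restriction [c < r] allows for [energy], whose time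
    derivative is computed for [r > 0]. *)
Lemma line_derivative f ft fr (c t0 al r0 be x : R) :
  (forall t r, 0 < t -> c < r -> has_der (f ^~ r) t (ft t r)) ->
  (forall t r, 0 < t -> c < r -> has_der (f t) r (fr t r)) ->
  ccont ft -> ccont fr -> 0 < t0 + al * x -> c < r0 + be * x ->
  has_der (fun y => f (t0 + al * y) (r0 + be * y)) x
    (al * ft (t0 + al * x) (r0 + be * x) + be * fr (t0 + al * x) (r0 + be * x)).
Proof.
move=> dft dfr cft cfr; set T := t0 + _; set S := r0 + _ => T0 S0.
apply: has_derP => e e0.
pose m := `|al| + `|be| + 1.
have al0 := normr_ge0 al; have be0 := normr_ge0 be.
have m0 : 0 < m by rewrite /m; lra.
have em0 : 0 < e / m by rewrite divr_gt0.
have [d1 d10 H1] := ccontP S cft T0 em0.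
have [d2 d20 H2] := ccontP S cfr T0 em0.
pose d := Num.min (Num.min T (S - c)) (Num.min d1 d2).
have d0 : 0 < d by rewrite !lt_min T0 subr_gt0 S0 d10.
exists (d / m); first by rewrite divr_gt0.
move=> h; rewrite ltr_pdivlMr// => hd.
have h0 := normr_ge0 h.
have alh : `|al * h| < d by rewrite normrM (le_lt_trans _ hd)// mulrC ler_wpM2l// /m; lra.
have beh : `|be * h| < d by rewrite normrM (le_lt_trans _ hd)// mulrC ler_wpM2l// /m; lra.
move: alh beh; rewrite !lt_min => /andP[/andP[alT _] /andP[al1 _]] /andP[/andP[_ beS] /andP[be1 be2]].
have beS' : c < S + be * h by move: beS; rewrite ltr_norml => /andP[+ _]; lra.
have -> : t0 + al * (x + h) = T + al * h by rewrite /T; ring.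
have -> : r0 + be * (x + h) = S + be * h by rewrite /S; ring.
have [t|xi xi1 E1] := @MVT_any (f ^~ (S + be * h)) (ft ^~ (S + be * h)) T (T + al * h).
  rewrite [T + _ - _]addrAC subrr add0r => tT; apply: dft => //.
  by have := le_lt_trans tT alT; rewrite ltr_norml => /andP[+ _]; lra.
have [r|eta eta1 E2] := @MVT_any (f T) (fr T) S (S + be * h).
  rewrite [S + _ - _]addrAC subrr add0r => rS; apply: dfr => //.
  by have := le_lt_trans rS beS; rewrite ltr_norml => /andP[+ _]; lra.
move: xi1 eta1; rewrite ![_ + _ * h - _]addrAC !subrr !add0r => xi1 eta1.
have -> : f (T + al * h) (S + be * h) - f T S - h * (al * ft T S + be * fr T S) =
    (ft xi (S + be * h) - ft T S) * (al * h) + (fr T eta - fr T S) * (be * h).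
  rewrite /= in E1 E2; have -> : f (T + al * h) (S + be * h) =
    f T S + fr T eta * (be * h) + ft xi (S + be * h) * (al * h).
    by move: E1 E2; rewrite ![_ + _ * h - _]addrAC !subrr !add0r => <- <-; ring.
  ring.
have A1 : `|ft xi (S + be * h) - ft T S| <= e / m.
  apply/ltW/H1; first exact: le_lt_trans al1.
  by rewrite addrAC subrr add0r.
have A2 : `|fr T eta - fr T S| <= e / m.
  apply/ltW/H2; first by rewrite subrr normr0.
  exact: le_lt_trans be2.
rewrite (le_trans (ler_normD _ _))// !normrM.
have -> : e * `|h| = e / m * (m * `|h|) by field; rewrite gt_eqF.
rewrite (@le_trans _ _ (e / m * (`|al| * `|h|) + e / m * (`|be| * `|h|)))//.
  by rewrite lerD// ler_wpM2r// mulr_ge0.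
by rewrite -mulrDr ler_wpM2l ?(ltW em0)// -mulrDl ler_wpM2r// /m; lra.
Qed.

Lemma C1_line f ft fr (t0 al r0 be x : R) : C1 f ft fr -> 0 < t0 + al * x ->
  has_der (fun y => f (t0 + al * y) (r0 + be * y)) x
    (al * ft (t0 + al * x) (r0 + be * x) + be * fr (t0 + al * x) (r0 + be * x)).
Proof.
move=> cf T0; apply: (@line_derivative _ _ _ (r0 + be * x - 1)) => //.
- by move=> t r t0' _; exact: (C1_t cf).
- by move=> t r t0' _; exact: (C1_r cf).
- exact: (C1_ct cf).
- exact: (C1_cr cf).
- lra.
Qed.

(** The second difference of [f] over a small square, divided by the area, is a value of either
    mixed derivative near [(t, r)]. *)
Lemma mixed_derivatives f ft fr ftt ftr frt frr t r :
  C1 f ft fr -> C1 ft ftt ftr -> C1 fr frt frr -> 0 < t -> ftr t r = frt t r.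
Proof.
move=> cf cft cfr t0; apply/eqP; rewrite -subr_eq0 -normr_eq0 eq_le normr_ge0 andbT.
apply/ler_addgt0Pl => e e0; rewrite addr0.
have e20 : 0 < e / 2 by lra.
have [d1 d10 H1] := ccontP r (C1_cr cft) t0 e20.
have [d2 d20 H2] := ccontP r (C1_ct cfr) t0 e20.
pose h := Num.min d1 d2 / 2.
have h0 : 0 < h by rewrite divr_gt0// lt_min d10.
have hd1 : h < d1.
  by rewrite (@lt_le_trans _ _ (Num.min d1 d2)) ?ge_min ?lexx// /h; move: h0; rewrite /h; lra.
have hd2 : h < d2.
  by rewrite (@lt_le_trans _ _ (Num.min d1 d2)) ?ge_min ?lexx ?orbT// /h; move: h0; rewrite /h; lra.
have th : t <= t + h by lra.
have rh : r <= r + h by lra.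
have [||x [y [xt yr E1]]] := @second_difference _ f ft ftr t (t + h) r (r + h) th rh.
- by move=> u v /andP[tu _] _; apply: (C1_t cf); lra.
- by move=> u v /andP[tu _] _; apply: (C1_r cft); lra.
have [||y' [x' [yr' xt' E2]]] := @second_difference _ (fun r t => f t r)
   (fun r t => fr t r) (fun r t => frt t r) r (r + h) t (t + h) rh th.
- by move=> u v _ /andP[tu _]; apply: (C1_r cf); lra.
- by move=> u v _ /andP[tu _]; apply: (C1_t cfr); lra.
have E : ftr x y = frt x' y'.
  apply: (@mulIf _ (h * h)); first by rewrite mulf_neq0 ?gt_eqF.
  have e1 : t + h - t = h by ring.
  have e2 : r + h - r = h by ring.
  move: E1 E2; rewrite !e1 !e2 -!mulrA => <- <-; ring.
have A1 : `|ftr x y - ftr t r| < e / 2.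
  by apply: H1; rewrite ger0_norm; lra.
have A2 : `|frt x' y' - frt t r| < e / 2.
  by apply: H2; rewrite ger0_norm; lra.
have -> : ftr t r - frt t r = (frt x' y' - frt t r) - (ftr x y - ftr t r).
  by rewrite E; ring.
by rewrite (le_trans (ler_normB _ _))//; lra.
Qed.

(** Differentiation under the integral sign in each of the two integrals of [prim], dominated by a
    constant that bounds [ft] on a compact rectangle. *)
Lemma der_prim_param f ft (t b : R) : ccont f -> ccont ft ->
  (forall t r, 0 < t -> has_der (f ^~ r) t (ft t r)) -> 0 < t ->
  has_der (fun t => prim (f t) b) t (prim (ft t) b).
Proof.
move=> cf cft df t0.
have t20 : 0 < t / 2 by rewrite divr_gt0.
have half c : has_der (fun t => \int[lebesgue_measure]_(s in `[-1, c]) f t s)%R t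
    (\int[lebesgue_measure]_(s in `[-1, c]) ft t s)%R.
  have [M M0 HM] := @ccont_bounded ft (t / 2) (t * 2) (-1) c cft t20.
  have d1E x y : 0 < x -> partial1of2 f x y = ft x y.
    by move=> x0; rewrite partial1of2E; have [_ ->] := df x y x0.
  have I0 x : x \in `]t / 2, t * 2[ -> 0 < x.
    by rewrite in_itv/= => /andP[+ _]; exact: lt_trans.
  have tin : t \in `]t / 2, t * 2[ by rewrite in_itv/=; apply/andP; split; lra.
  have := @cvg_differentiation_under_integral R _ _ lebesgue_measure f `[-1, c]
    (measurable_itv _) t (t / 2) (t * 2) tin _ _ (cst M) (fun=> M0) _ _.
  have H1 x : `](t / 2), (t * 2)[%classic x ->
      lebesgue_measure.-integrable `[-1, c] (EFin \o f x).
    by move=> /I0 x0; apply: cont_integrable; exact: ccont_slice.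
  have H2 x y : `](t / 2), (t * 2)[%classic x -> `[(-1), c]%classic y -> derivable (f ^~ y) x 1.
    by move=> /I0 x0 _; have [] := df x y x0.
  have H3 : lebesgue_measure.-integrable `[-1, c] (EFin \o (cst M : R -> R)).
    by apply: cont_integrable; exact: cst_continuous.
  have H4 x y : `](t / 2), (t * 2)[%classic x -> `[(-1), c]%classic y ->
     `|partial1of2 f x y| <= cst M y.
    move=> xI; have := xI; rewrite /= in_itv/= => /andP[x1 x2] yI.
    by rewrite d1E ?(I0 _ xI)//; apply: HM; rewrite ?(ltW x1) ?(ltW x2).
  move=> /(_ H1 H2 H3 H4) cv.
  have cv' : h^-1 *: ((\int[lebesgue_measure]_(s in `[-1, c]) f (h *: 1 + t) s)%R -
      (\int[lebesgue_measure]_(s in `[-1, c]) f t s)%R) @[h --> 0^'] -->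
      (\int[lebesgue_measure]_(s in `[-1, c]) ft t s)%R.
    have <- : (\int[lebesgue_measure]_(s in `[-1, c]) partial1of2 f t s)%R =
        (\int[lebesgue_measure]_(s in `[-1, c]) ft t s)%R.
      by apply: eq_Rintegral => y _; rewrite d1E.
    by under eq_fun do rewrite [_ *: 1]mulr1.
  apply: DeriveDef; first by apply/cvg_ex; eexists; exact: cv'.
  exact: cvg_lim cv'.
exact: derB.
Qed.

End TwoVariables.

(** * The wave equation *)

Ltac ccont_step :=
  match goal with
  | |- ccont (fun t r => r) => exact (@ccont_r _)
  | |- ccont (fun t r => ?c) => exact (@ccont_cst _ c)
  | |- ccont (fun t r => @?f t r + @?g t r) => simple refine (@ccontD _ f g _ _)
  | |- ccont (fun t r => - @?f t r) => simple refine (@ccontN _ f _)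
  | |- ccont (fun t r => @?f t r * @?g t r) => simple refine (@ccontM _ f g _ _)
  | |- ccont (fun t r => @?f t r ^+ ?n) => simple refine (@ccontX _ f n _)
  | _ => assumption
  end; cbn beta.

Ltac ccont_tac := repeat ccont_step.

Section Wave.
Context {R : realType} (w wt wr wtt wtr wrt wrr : R -> R -> R).
Context (w_cont : ccont w) (w_C1 : C1 w wt wr) (wt_C1 : C1 wt wtt wtr)
  (wr_C1 : C1 wr wrt wrr).
Context (w_eq : forall t r : R, 0 < t -> 0 < r ->
  wtt t r = wrr t r + 3 / r * wr t r + w t r ^+ 3).

(** * Energy density, flux and conservation of energy *)

Definition psi (t r : R) := r * w t r.
Definition psit (t r : R) := r * wt t r.
Definition psir (t r : R) := w t r + r * wr t r.

(* [r] times the energy density and the energy flux of [psi], written in terms of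
   [w] so as to be smooth at [r = 0]; see [edens_psi] and [eflux_psi]. *)
Definition edens (t r : R) := 2^-1 * r ^+ 3 * (wt t r ^+ 2 + wr t r ^+ 2)
  + r ^+ 2 * (w t r * wr t r) + r * w t r ^+ 2 - 4^-1 * r ^+ 3 * w t r ^+ 4.
Definition eflux (t r : R) := r ^+ 2 * (wt t r * w t r) + r ^+ 3 * (wt t r * wr t r).

Definition edens_t (t r : R) := r ^+ 3 * (wt t r * wtt t r + wr t r * wrt t r)
  + r ^+ 2 * (wt t r * wr t r + w t r * wrt t r) + 2 * r * (w t r * wt t r)
  - r ^+ 3 * (w t r ^+ 3 * wt t r).
Definition edens_r (t r : R) := 2^-1 * (3 * r ^+ 2) * (wt t r ^+ 2 + wr t r ^+ 2)
  + r ^+ 3 * (wt t r * wtr t r + wr t r * wrr t r)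
  + 2 * r * (w t r * wr t r) + r ^+ 2 * (wr t r ^+ 2 + w t r * wrr t r)
  + w t r ^+ 2 + 2 * r * (w t r * wr t r)
  - 4^-1 * (3 * r ^+ 2) * w t r ^+ 4 - r ^+ 3 * (w t r ^+ 3 * wr t r).
Definition eflux_t (t r : R) := r ^+ 2 * (wtt t r * w t r + wt t r ^+ 2)
  + r ^+ 3 * (wtt t r * wr t r + wt t r * wrt t r).
Definition eflux_r (t r : R) := 2 * r * (wt t r * w t r)
  + r ^+ 2 * (wtr t r * w t r + wt t r * wr t r)
  + 3 * r ^+ 2 * (wt t r * wr t r) + r ^+ 3 * (wtr t r * wr t r + wt t r * wrr t r).

Let wt_cont := C1_ct w_C1.
Let wr_cont := C1_cr w_C1.
Let wtt_cont := C1_ct wt_C1.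
Let wtr_cont := C1_cr wt_C1.
Let wrt_cont := C1_ct wr_C1.
Let wrr_cont := C1_cr wr_C1.

Lemma edens_cont : ccont edens.
Proof. by rewrite /edens; ccont_tac. Qed.

Lemma edens_t_cont : ccont edens_t.
Proof. by rewrite /edens_t; ccont_tac. Qed.

Lemma eflux_cont : ccont eflux.
Proof. by rewrite /eflux; ccont_tac. Qed.

Lemma edens_C1 : C1 edens edens_t edens_r.
Proof.
split; last 2 first.
- exact: edens_t_cont.
- by rewrite /edens_r; ccont_tac.
- move=> t r t0; rewrite /edens.
  have h := C1_t w_C1 r t0; have ht := C1_t wt_C1 r t0; have hr := C1_t wr_C1 r t0.
  by der; rewrite /edens_t/=; field.
- move=> t r t0; rewrite /edens.
  have h := C1_r w_C1 r t0; have ht := C1_r wt_C1 r t0; have hr := C1_r wr_C1 r t0.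
  by der; rewrite /edens_r/=; field.
Qed.

Lemma eflux_C1 : C1 eflux eflux_t eflux_r.
Proof.
split; last 2 first.
- by rewrite /eflux_t; ccont_tac.
- by rewrite /eflux_r; ccont_tac.
- move=> t r t0; rewrite /eflux.
  have h := C1_t w_C1 r t0; have ht := C1_t wt_C1 r t0; have hr := C1_t wr_C1 r t0.
  by der; rewrite /eflux_t/=; ring.
- move=> t r t0; rewrite /eflux.
  have h := C1_r w_C1 r t0; have ht := C1_r wt_C1 r t0; have hr := C1_r wr_C1 r t0.
  by der; rewrite /eflux_r/=; ring.
Qed.

Lemma psi_der t r : 0 < t -> has_der (psi t) r (psir t r).
Proof.
move=> t0; rewrite /psi.
by have h := C1_r w_C1 r t0; der; rewrite /psir/=; ring.
Qed.

(** This is the equation for [psi] multiplied by [r psi_t]. *)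
Lemma energy_identity t r : 0 < t -> 0 < r -> edens_t t r = eflux_r t r.
Proof.
move=> t0 r0; rewrite /edens_t /eflux_r (mixed_derivatives r w_C1 wt_C1 wr_C1 t0) w_eq//.
by field; rewrite gt_eqF.
Qed.

(** For [b >= 0] this is the energy of [w] in the ball of radius [b] plus the boundary term
    [psi ^ 2 / 2] at [r = b], the integral of [r ^ 2 w w_r + r w ^ 2]. *)
Definition energy (t b : R) := prim (edens t) b.

Lemma energy_dr t b : 0 < t -> -1 < b -> has_der (energy t) b (edens t b).
Proof. by move=> t0 b1; apply: der_prim => //; exact: (ccont_slice edens_cont). Qed.

(** The conservation law integrated over [[0, b]]; there is no flux through the origin. *)
Lemma energy_dt t b : 0 < t -> 0 < b -> has_der (energy ^~ b) t (eflux t b).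
Proof.
move=> t0 b0.
have -> : eflux t b = prim (edens_t t) b.
  have dq x : has_der (eflux t) x (eflux_r t x) by exact: (C1_r eflux_C1).
  have dp x : 0 <= x -> has_der (prim (edens_t t)) x (edens_t t x).
    by move=> x0; apply: der_prim; [exact: (ccont_slice edens_t_cont)|lra].
  have q0 : eflux t 0 = 0 by rewrite /eflux; ring.
  (* [energy_identity] holds for [r > 0], so the two sides are compared through their derivatives in
     the open interval, once in each direction. *)
  apply: le_anti; apply/andP; split.
    have := @der_le _ (eflux t) (prim (edens_t t)) (eflux_r t) (edens_t t) 0 b (ltW b0).
    rewrite prim0 q0 !subr0; apply => // x /andP[x0 xb].
      exact: dp.
    by rewrite energy_identity.
  have := @der_le _ (prim (edens_t t)) (eflux t) (edens_t t) (eflux_r t) 0 b (ltW b0).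
  rewrite prim0 q0 !subr0; apply => // x /andP[x0 xb].
    exact: dp.
  by rewrite energy_identity.
exact (@der_prim_param _ edens edens_t t b edens_cont edens_t_cont (C1_t edens_C1) t0).
Qed.

Lemma energy_line (t0 al r0 be x : R) : 0 < t0 + al * x -> 0 < r0 + be * x ->
  has_der (fun y => energy (t0 + al * y) (r0 + be * y)) x
    (al * eflux (t0 + al * x) (r0 + be * x) + be * edens (t0 + al * x) (r0 + be * x)).
Proof.
move=> T0 S0.
have dr t r : 0 < t -> 0 < r -> has_der (energy t) r (edens t r).
  by move=> t1 rr; apply: energy_dr => //; lra.
exact (@line_derivative _ energy eflux edens 0 _ _ _ _ _ energy_dt dr eflux_cont edens_cont T0 S0).
Qed.

(** * Coercivity and null fluxes where [|psi| <= 1] *)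

Lemma edens_psi t r : 0 < r -> edens t r =
  2^-1 * (r * psit t r ^+ 2 + r * psir t r ^+ 2)
  + (2^-1 * psi t r ^+ 2 - 4^-1 * psi t r ^+ 4) / r.
Proof. by move=> r0; rewrite /edens /psi /psit /psir; field; rewrite gt_eqF. Qed.

Lemma eflux_psi t r : eflux t r = r * (psit t r * psir t r).
Proof. by rewrite /eflux /psit /psir; ring. Qed.

Lemma potential_ge (x : R) : `|x| <= 1 -> 4^-1 * x ^+ 2 <= 2^-1 * x ^+ 2 - 4^-1 * x ^+ 4.
Proof.
move=> x1; have : x ^+ 2 * x ^+ 2 <= x ^+ 2 * 1.
  by rewrite ler_wpM2l ?sqr_ge0// -[_ ^+ 2]real_normK ?num_real// expr_le1.
by rewrite mulr1 -exprD; lra.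
Qed.

Lemma edens_ge t r : 0 < r -> `|psi t r| <= 1 ->
  2^-1 * (r * psit t r ^+ 2 + r * psir t r ^+ 2) + 4^-1 * (psi t r ^+ 2 / r) <= edens t r.
Proof.
move=> r0 ps1; rewrite edens_psi// lerD2l mulrA ler_wpM2r ?invr_ge0 ?(ltW r0)//.
exact: potential_ge.
Qed.

Lemma edens_ge_r t r : 0 < r -> `|psi t r| <= 1 -> 4^-1 * (psi t r ^+ 2 / r) <= edens t r.
Proof.
move=> r0 ps1; apply: le_trans (edens_ge r0 ps1).
have := mulr_ge0 (ltW r0) (sqr_ge0 (psit t r)).
by have := mulr_ge0 (ltW r0) (sqr_ge0 (psir t r)); lra.
Qed.

(** Integrated in [r], this lets energy increments control the variation of [psi ^ 2]. *)
Lemma psi_psir_le t r : 0 < r -> `|psi t r| <= 1 -> `|2 * psi t r * psir t r| <= 4 * edens t r.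
Proof.
move=> r0 ps1; have := edens_ge r0 ps1.
have A := mulr_ge0 (ltW r0) (sqr_ge0 (psit t r)).
have B : 0 <= r * (psir t r + psi t r / r) ^+ 2 by rewrite mulr_ge0 ?sqr_ge0 ?ltW.
have C : 0 <= r * (psir t r - psi t r / r) ^+ 2 by rewrite mulr_ge0 ?sqr_ge0 ?ltW.
have EB : r * (psir t r + psi t r / r) ^+ 2 =
    r * psir t r ^+ 2 + psi t r ^+ 2 / r + 2 * psi t r * psir t r by field; rewrite gt_eqF.
have EC : r * (psir t r - psi t r / r) ^+ 2 =
    r * psir t r ^+ 2 + psi t r ^+ 2 / r - 2 * psi t r * psir t r by field; rewrite gt_eqF.
have D := mulr_ge0 (ltW r0) (sqr_ge0 (psir t r)).
by move=> E; rewrite ler_norml; apply/andP; split; lra.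
Qed.

Lemma density_le t r : 0 < r -> `|psi t r| <= 1 ->
  (wt t r ^+ 2 + wr t r ^+ 2 + w t r ^+ 2 / r ^+ 2) * r ^+ 3 <= 12 * edens t r.
Proof.
move=> r0 ps1; have := edens_ge r0 ps1.
have rn0 : r != 0 by rewrite gt_eqF.
have A := mulr_ge0 (ltW r0) (sqr_ge0 (psit t r)).
have B := mulr_ge0 (ltW r0) (sqr_ge0 (psir t r)).
have C : 0 <= r * (psir t r + w t r) ^+ 2 by rewrite mulr_ge0 ?sqr_ge0 ?ltW.
(* As [r w_r = psi_r - w], the left side is at most [r psi_t ^ 2 + 2 r psi_r ^ 2 + 3 r w ^ 2]. The
   last term is [3 psi ^ 2 / r], and the coercivity constant [1 / 4] turns 3 into 12. *)
have -> : (wt t r ^+ 2 + wr t r ^+ 2 + w t r ^+ 2 / r ^+ 2) * r ^+ 3 =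
   r * psit t r ^+ 2 + r * (psir t r - w t r) ^+ 2 + r * w t r ^+ 2.
  by rewrite /psit /psir; field.
have -> : psi t r ^+ 2 / r = r * w t r ^+ 2 by rewrite /psi; field.
have D : r * (psir t r - w t r) ^+ 2 + r * (psir t r + w t r) ^+ 2 =
  2 * (r * psir t r ^+ 2) + 2 * (r * w t r ^+ 2) by ring.
by lra.
Qed.

(** Each is a square plus the potential energy. They are the flux densities through outgoing and
    incoming light cones, respectively. *)
Lemma flux_ge0 t r : 0 < r -> `|psi t r| <= 1 -> 0 <= edens t r + eflux t r /\ 0 <= edens t r - eflux t r.
Proof.
move=> r0 ps1; have := edens_ge r0 ps1; rewrite eflux_psi => P.
have B : 0 <= r * (psit t r + psir t r) ^+ 2 by rewrite mulr_ge0 ?sqr_ge0 ?ltW.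
have C : 0 <= r * (psit t r - psir t r) ^+ 2 by rewrite mulr_ge0 ?sqr_ge0 ?ltW.
have D : 0 <= psi t r ^+ 2 / r by rewrite mulr_ge0 ?sqr_ge0 ?invr_ge0 ?ltW.
have EB : r * (psit t r + psir t r) ^+ 2 = r * psit t r ^+ 2 + r * psir t r ^+ 2
  + 2 * (r * (psit t r * psir t r)) by ring.
have EC : r * (psit t r - psir t r) ^+ 2 = r * psit t r ^+ 2 + r * psir t r ^+ 2
  - 2 * (r * (psit t r * psir t r)) by ring.
by split; lra.
Qed.

(** The left side is the derivative of [edens - eflux] in the outgoing null direction. The equation
    cancels all second derivatives and leaves terms of the size of the energy density divided by
    [r]. *)
Lemma flux_transport t r : 0 < t -> 0 < r -> edens_t t r - eflux_t t r + (edens_r t r - eflux_r t r) =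
  2^-1 * (psit t r + psir t r) * (psit t r - psir t r)
  + 2 * (psi t r - psi t r ^+ 3) * psir t r / r
  - (2^-1 * psi t r ^+ 2 - 4^-1 * psi t r ^+ 4) / r ^+ 2.
Proof.
move=> t0 r0; rewrite energy_identity// /edens_r /eflux_r /eflux_t.
rewrite (mixed_derivatives r w_C1 wt_C1 wr_C1 t0) w_eq// /psi /psit /psir.
by field; rewrite gt_eqF.
Qed.

(** The free weight [s] in the inequality of arithmetic and geometric means distributes the bound
    between the two null fluxes. *)
Lemma flux_transport_le t r (s : R) : 0 < t -> 0 < r -> `|psi t r| <= 1 -> 0 < s ->
  `|edens_t t r - eflux_t t r + (edens_r t r - eflux_r t r)| <=
    4 / r * (s * (edens t r + eflux t r) + s^-1 * (edens t r - eflux t r)).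
Proof.
move=> t0 r0 ps1 s0; rewrite flux_transport//.
set a := psit t r + psir t r; set b := psit t r - psir t r.
set x := psi t r; set F := 2^-1 * x ^+ 2 - 4^-1 * x ^+ 4.
(* With [y = x ^ 2] the difference of the two sides is [y + y ^ 2 - y ^ 3], nonnegative on
   [[0, 1]]. *)
have F4 : (x - x ^+ 3) ^+ 2 <= 4 * F.
  have x2 : x ^+ 2 <= 1 by rewrite -[_ ^+ 2]real_normK ?num_real// expr_le1.
  have := sqr_ge0 x; rewrite /F; move: x2.
  have -> : (x - x ^+ 3) ^+ 2 = x ^+ 2 * (1 - x ^+ 2) ^+ 2 by ring.
  have -> : x ^+ 4 = (x ^+ 2) ^+ 2 by ring.
  by move: (x ^+ 2) => y; nra.
have F0 : 0 <= F by have := sqr_ge0 (x - x ^+ 3); lra.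
have -> : edens t r + eflux t r = 2^-1 * (r * a ^+ 2) + F / r.
  by rewrite edens_psi// eflux_psi /a /F /x; field; rewrite gt_eqF.
have -> : edens t r - eflux t r = 2^-1 * (r * b ^+ 2) + F / r.
  by rewrite edens_psi// eflux_psi /b /F /x; field; rewrite gt_eqF.
have -> : psir t r = 2^-1 * (a - b) by rewrite /a /b; field.
move: F4; set f := x - x ^+ 3; move=> F4.
have rn0 : r != 0 by rewrite gt_eqF.
have sn0 : s != 0 by rewrite gt_eqF.
rewrite -(@ler_pM2l _ r)// -[X in X * `|_|](gtr0_norm r0) -normrM.
have -> : r * (4 / r * (s * (2^-1 * (r * a ^+ 2) + F / r) + s^-1 * (2^-1 * (r * b ^+ 2) + F / r))) =
  2 * (r * s * a ^+ 2) + 4 * (s * F / r) + 2 * (r / s * b ^+ 2) + 4 * (F / (s * r)) by field; apply/andP.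
have -> : r * (2^-1 * a * b + 2 * f * (2^-1 * (a - b)) / r - F / r ^+ 2) =
  2^-1 * (r * a * b) + f * a - f * b - F / r by field.
(* AM-GM for each of the products [ab], [fa], [fb] *)
have sq (k y z : R) : 0 < k -> `|y * z| <= 2^-1 * (k * y ^+ 2 + z ^+ 2 / k).
  move=> k0; have kn0 : k != 0 by rewrite gt_eqF.
  have B : 0 <= (k * y + z) ^+ 2 / k by rewrite mulr_ge0 ?sqr_ge0 ?invr_ge0 ?ltW.
  have C : 0 <= (k * y - z) ^+ 2 / k by rewrite mulr_ge0 ?sqr_ge0 ?invr_ge0 ?ltW.
  have EB : (k * y + z) ^+ 2 / k = k * y ^+ 2 + z ^+ 2 / k + 2 * (y * z) by field.
  have EC : (k * y - z) ^+ 2 / k = k * y ^+ 2 + z ^+ 2 / k - 2 * (y * z) by field.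
  by rewrite ler_norml; apply/andP; split; lra.
have rs0 : 0 < r * s by rewrite mulr_gt0.
have rs'0 : 0 < r / s by rewrite divr_gt0.
have H1 : `|r * a * b| <= 2^-1 * (r * s * a ^+ 2 + r / s * b ^+ 2).
  have := sq s a b s0; rewrite -(ler_pM2l r0) -[X in X * `|_|](gtr0_norm r0) -normrM mulrA.
  by move/le_trans; apply; rewrite le_eqVlt; apply/orP; left; apply/eqP; field.
have H2 : `|f * a| <= 2^-1 * (r * s * a ^+ 2) + 2 * (F / (s * r)).
  have := sq _ a f rs0; rewrite [a * f]mulrC => /le_trans; apply.
  have -> : f ^+ 2 / (r * s) = (s * r)^-1 * f ^+ 2 by field; apply/andP.
  have : (s * r)^-1 * f ^+ 2 <= (s * r)^-1 * (4 * F).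
    by rewrite ler_wpM2l// invr_ge0 mulr_ge0 ?ltW.
  have -> : F / (s * r) = (s * r)^-1 * F by field; apply/andP.
  by lra.
have H3 : `|f * b| <= 2^-1 * (r / s * b ^+ 2) + 2 * (s * F / r).
  have := sq _ b f rs'0; rewrite [b * f]mulrC => /le_trans; apply.
  have -> : f ^+ 2 / (r / s) = (s / r) * f ^+ 2 by field; apply/andP.
  have : s / r * f ^+ 2 <= s / r * (4 * F) by rewrite ler_wpM2l// divr_ge0 ?ltW.
  have -> : s * F / r = s / r * F by field.
  by lra.
have H4 : `|F / r| <= 2^-1 * (s * F / r + F / (s * r)).
  have sF : 0 <= F / r by rewrite divr_ge0// ltW.
  have := sq s 1 1 s0; rewrite mulr1 normr1 expr1n mulr1 => H.
  rewrite ger0_norm//.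
  have -> : s * F / r = s * (F / r) by field.
  have -> : F / (s * r) = s^-1 * (F / r) by field; apply/andP.
  by move: H; rewrite div1r => H; nra.
have P1 : 0 <= r * s * a ^+ 2 by rewrite mulr_ge0 ?sqr_ge0 ?ltW.
have P2 : 0 <= r / s * b ^+ 2 by rewrite mulr_ge0 ?sqr_ge0 ?ltW.
have P3 : 0 <= s * F / r by rewrite divr_ge0 ?mulr_ge0 ?(ltW s0) ?(ltW r0).
have P4 : 0 <= F / (s * r) by rewrite divr_ge0 ?mulr_ge0 ?(ltW s0) ?(ltW r0).
move: H1 H2 H3 H4; rewrite !ler_norml => /andP[? ?] /andP[? ?] /andP[? ?] /andP[? ?].
by apply/andP; split; lra.
Qed.

(** * Bounds on [psi] and on the energy from the bounded norm *)

Definition mass (t r : R) := r ^+ 3 * (wt t r ^+ 2 + wr t r ^+ 2).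

(** [C0] bounds the squared energy norm uniformly in time; [w_vanishes] allows [w] to be recovered
    by integrating [wr] from infinity. *)
Context (C0 : R) (C0_ge0 : (0 : R) <= C0)
  (mass_le : forall t b : R, 0 < t -> 0 <= b -> prim (mass t) b <= C0)
  (w_vanishes : forall t b e : R, 0 < t -> 0 < e -> exists2 b', b < b' & `|w t b'| < e).

Lemma mass_cont : ccont mass.
Proof. by rewrite /mass; ccont_tac. Qed.

Lemma mass_der t b : 0 < t -> -1 < b -> has_der (prim (mass t)) b (mass t b).
Proof. by move=> t0 b1; apply: der_prim => //; exact: (ccont_slice mass_cont). Qed.

Lemma mass_ge0 t r : 0 <= r -> 0 <= mass t r.
Proof. by move=> r0; rewrite mulr_ge0 ?addr_ge0 ?sqr_ge0 ?exprn_ge0. Qed.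

Lemma mass_mono t a b : 0 < t -> 0 <= a -> a <= b -> prim (mass t) a <= prim (mass t) b.
Proof.
move=> t0 a0 ab; apply: der_ge0 ab _ _ => [x /andP[ax _]|x /andP[ax _]].
  by apply: mass_der => //; lra.
by apply: mass_ge0; lra.
Qed.

Lemma mass_prim_ge0 t b : 0 < t -> 0 <= b -> 0 <= prim (mass t) b.
Proof. by move=> t0 b0; rewrite -[leLHS](prim0 (mass t)); exact: mass_mono. Qed.

Lemma w_difference t a b (th : R) : 0 < t -> 0 < a -> a <= b -> 0 < th ->
  a * `|w t b - w t a| <=
    2^-1 * th * (prim (mass t) b - prim (mass t) a) + 4^-1 / th.
Proof.
move=> t0 a0 ab th0.
(* [G] is a primitive of the bound [(k (wr ^ 2 + wt ^ 2) + 1 / k) / 2] for [|wr|], where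
   [k = (th / a) x ^ 3]. *)
pose G x := 2^-1 * (th / a) * prim (mass t) x - 4^-1 * (a / th) * x ^- 2.
pose dG x := 2^-1 * (th / a) * mass t x + 2^-1 * (a / th) * x ^- 3.
have x0 x : a <= x <= b -> 0 < x by move=> /andP[ax _]; lra.
have dGP x : a <= x <= b -> has_der G x (dG x).
  move=> /x0 xp; rewrite /G.
  have hm : has_der (prim (mass t)) x (mass t x) by apply: mass_der => //; lra.
  have hx : has_der (fun y : R => y ^+ 2) x (2 * x) by der; rewrite /=; ring.
  have hV := @derV _ (fun y : R => y ^+ 2) x _ (lt0r_neq0 (exprn_gt0 2 xp)) hx.
  by der; rewrite /dG; field; rewrite !gt_eqF.
have wrP x : a < x < b -> `|wr t x| <= dG x.
  move=> /andP[ax xb]; have xp : 0 < x by lra.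
  pose k := th / a * x ^+ 3.
  have k0 : 0 < k by rewrite mulr_gt0 ?divr_gt0 ?exprn_gt0.
  have -> : dG x = 2^-1 * (k * wr t x ^+ 2 + k^-1) + 2^-1 * (k * wt t x ^+ 2).
    by rewrite /dG /k /mass; field; rewrite !gt_eqF.
  have B : 0 <= (k * wr t x + 1) ^+ 2 / k by rewrite divr_ge0 ?sqr_ge0 ?ltW.
  have C : 0 <= (k * wr t x - 1) ^+ 2 / k by rewrite divr_ge0 ?sqr_ge0 ?ltW.
  have EB : (k * wr t x + 1) ^+ 2 / k = k * wr t x ^+ 2 + k^-1 + 2 * wr t x by field; rewrite gt_eqF.
  have EC : (k * wr t x - 1) ^+ 2 / k = k * wr t x ^+ 2 + k^-1 - 2 * wr t x by field; rewrite gt_eqF.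
  have D : 0 <= k * wt t x ^+ 2 by rewrite mulr_ge0 ?sqr_ge0 ?ltW.
  by rewrite ler_norml; apply/andP; split; lra.
have dw x : a <= x <= b -> has_der (w t) x (wr t x) by move=> _; exact: (C1_r w_C1).
have A1 : w t b - w t a <= G b - G a.
  apply: (der_le ab dw dGP) => x /wrP; exact: le_trans (ler_norm _).
have A2 : - w t b - - w t a <= G b - G a.
  apply: (@der_le _ (fun x => - w t x) G (fun x => - wr t x) dG _ _ ab) => // [x xab|x /wrP].
    by apply: derN; exact: dw.
  by apply: le_trans; rewrite -normrN; exact: ler_norm.
have A3 : `|w t b - w t a| <= G b - G a by rewrite ler_norml; apply/andP; split; lra.
have : a * `|w t b - w t a| <= a * (G b - G a) by rewrite ler_wpM2l// ltW.
move=> /le_trans; apply.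
have bp : 0 < b by lra.
have -> : a * (G b - G a) = 2^-1 * th * (prim (mass t) b - prim (mass t) a)
   + 4^-1 / th - 4^-1 * (a ^+ 2 / th) * b ^- 2.
  by rewrite /G; field; rewrite !gt_eqF.
have : 0 <= 4^-1 * (a ^+ 2 / th) * b ^- 2.
  by rewrite mulr_ge0 ?invr_ge0 ?exprn_ge0 ?(ltW bp)// mulr_ge0// divr_ge0 ?sqr_ge0 ?ltW.
by lra.
Qed.

(** [w_difference] with [b] chosen beyond [a] so that [w t b] is negligible. *)
Lemma psi_tail_le t a (S th : R) : 0 < t -> 0 < a -> 0 < th ->
  (forall b, a <= b -> prim (mass t) b <= S) ->
  `|psi t a| <= 2^-1 * th * (S - prim (mass t) a) + 4^-1 / th.
Proof.
move=> t0 a0 th0 HS; apply/ler_addgt0Pr => e e0.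
have [b ab wb] := w_vanishes a t0 (divr_gt0 e0 a0).
have := w_difference t0 a0 (ltW ab) th0.
have := HS b (ltW ab); set Mb := prim _ b; set Ma := prim _ a => MS.
have : 2^-1 * th * (Mb - Ma) <= 2^-1 * th * (S - Ma).
  by rewrite ler_wpM2l ?lerD2r// mulr_ge0// ltW.
have : `|psi t a| <= a * `|w t b - w t a| + a * `|w t b|.
  rewrite /psi normrM (gtr0_norm a0) -mulrDr ler_wpM2l ?(ltW a0)//.
  have -> : w t a = w t b - (w t b - w t a) by ring.
  by rewrite (le_trans (ler_normB _ _))// opprB addrCA subrr addr0 addrC.
have : a * `|w t b| <= e by rewrite mulrC -ler_pdivlMr// ltW.
by lra.
Qed.

(** The bound of [psi_tail_le] for [th = 1] and [S = C0], without the tail gain. *)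
Definition psi_sup : R := 2^-1 * C0 + 4^-1.

Lemma psi_sup_ge0 : 0 <= psi_sup.
Proof. by rewrite addr_ge0 ?mulr_ge0. Qed.

Lemma psi_le t r : 0 < t -> 0 <= r -> `|psi t r| <= psi_sup.
Proof.
move=> t0; rewrite le_eqVlt => /predU1P[<-|r0].
  by rewrite /psi mul0r normr0 psi_sup_ge0.
have H b : r <= b -> prim (mass t) b <= C0 by move=> rb; apply: mass_le => //; lra.
have := psi_tail_le t0 r0 ltr01 H; rewrite divr1 => /le_trans; apply.
have := mass_prim_ge0 t0 (ltW r0); rewrite /psi_sup; lra.
Qed.

Lemma tail_small (t e : R) : 0 < t -> 0 < e -> exists2 B, 0 < B & forall a, B <= a ->
  `|psi t a| <= e /\ forall b, a <= b -> prim (mass t) b - prim (mass t) a <= e.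
Proof.
move=> t0 e0; pose E := [set prim (mass t) b | b in [set b | 0 <= b]].
have supE : has_sup E.
  split; first by exists (prim (mass t) 0), 0 => /=.
  by exists C0 => _ [b /= b0 <-]; exact: mass_le.
have leE b : 0 <= b -> prim (mass t) b <= sup E.
  by move=> b0; apply: sup_upper_bound => //; exists b.
(* With [th = 1 / e], a tail of mass at most [e ^ 2] gives [|psi| <= e / 2 + e / 4]. *)
pose d := Num.min e (e ^+ 2).
have d0 : 0 < d by rewrite lt_min e0 exprn_gt0.
have [_ [B /= B0 <-] HB] := sup_adherent d0 supE.
exists (B + 1) => [|a Ba]; first by lra.
have a0 : 0 < a by lra.
have aB : prim (mass t) B <= prim (mass t) a by apply: mass_mono => //; lra.
split; last first.
  move=> b ab; have b0 : 0 <= b by lra.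
  have := leE b b0; have : d <= e by rewrite ge_min lexx.
  by lra.
have H b : a <= b -> prim (mass t) b <= sup E by move=> ab; apply: leE; lra.
have th0 : 0 < e^-1 by rewrite invr_gt0.
have := psi_tail_le t0 a0 th0 H => /le_trans; apply.
rewrite invrK.
have : 2^-1 * e^-1 * (sup E - prim (mass t) a) <= 2^-1 * e^-1 * e ^+ 2.
  rewrite ler_wpM2l ?mulr_ge0 ?(ltW th0)//.
  have : d <= e ^+ 2 by rewrite ge_min lexx orbT.
  by lra.
have -> : 2^-1 * e^-1 * e ^+ 2 = 2^-1 * e by field; rewrite gt_eqF.
by lra.
Qed.

(** In [psi_r = w + r w_r], the first term is at most [psi_sup / a], and the second is split into a
    small multiple of [mass] and a multiple of [1 / r]. The modulus is thus uniform in time and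
    invariant under scaling. *)
Lemma psi_holder (e : R) : 0 < e -> exists2 d, 0 < d & forall t a b : R,
  0 < t -> 0 < a -> a <= b -> b - a <= d * a -> `|psi t b - psi t a| <= e.
Proof.
(* This [k] makes the contribution of [mass] at most [e / 2]; the choice of [d] below does the same
   for the term with [L]. *)
move=> e0; pose k := e / (C0 + 1).
have k0 : 0 < k by rewrite divr_gt0// ltr_wpDl.
have s0 := psi_sup_ge0.
pose L := 2^-1 / k + psi_sup.
have L0 : 0 < L by rewrite /L ltr_wpDr// divr_gt0.
exists (2^-1 * e / L); first by rewrite divr_gt0 ?mulr_gt0.
move=> t a b t0 a0 ab bad.
pose G x := 2^-1 * k * prim (mass t) x + L / a * x.
pose dG x := 2^-1 * k * mass t x + L / a.
have dGP x : a <= x <= b -> has_der G x (dG x).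
  move=> /andP[ax _]; rewrite /G.
  have hm : has_der (prim (mass t)) x (mass t x) by apply: mass_der => //; lra.
  by der; rewrite /dG; ring.
have rP x : a < x < b -> `|psir t x| <= dG x.
  move=> /andP[ax xb]; have xp : 0 < x by lra.
  have W : `|w t x| <= psi_sup / a.
    rewrite ler_pdivlMr//; apply: le_trans (psi_le t0 (ltW xp)).
    by rewrite /psi normrM (gtr0_norm xp) mulrC ler_wpM2r// ltW.
  have : `|x * wr t x| <= 2^-1 * k * mass t x + 2^-1 / k / a.
    have x1 : x^-1 <= a^-1 by rewrite lef_pV2// ltW.
    have : 2^-1 / k / x <= 2^-1 / k / a by rewrite ler_wpM2l// divr_ge0 ?ltW.
    have k1 := ltW k0; have xp1 := ltW xp; have kx := mulr_ge0 k1 xp1.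
    have := mulr_ge0 (mulr_ge0 k1 (exprn_ge0 3 xp1)) (sqr_ge0 (wt t x)).
    have B : 0 <= (k * x ^+ 2 * wr t x + 1) ^+ 2 / (k * x) by rewrite divr_ge0 ?sqr_ge0.
    have C : 0 <= (k * x ^+ 2 * wr t x - 1) ^+ 2 / (k * x) by rewrite divr_ge0 ?sqr_ge0.
    have EB : (k * x ^+ 2 * wr t x + 1) ^+ 2 / (k * x) = k * x ^+ 3 * wr t x ^+ 2 + 2 * (2^-1 / k / x) + 2 * (x * wr t x) by field; rewrite !gt_eqF.
    have EC : (k * x ^+ 2 * wr t x - 1) ^+ 2 / (k * x) = k * x ^+ 3 * wr t x ^+ 2 + 2 * (2^-1 / k / x) - 2 * (x * wr t x) by field; rewrite !gt_eqF.
    have -> : 2^-1 * k * mass t x = 2^-1 * (k * x ^+ 3 * wt t x ^+ 2) + 2^-1 * (k * x ^+ 3 * wr t x ^+ 2) by rewrite /mass; ring.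
    by move=> ? ?; rewrite ler_norml; apply/andP; split; lra.
  rewrite /psir /dG /L mulrDl => H.
  by rewrite (le_trans (ler_normD _ _))//; lra.
have dw x : a <= x <= b -> has_der (psi t) x (psir t x) by move=> _; exact: psi_der.
have A1 : psi t b - psi t a <= G b - G a.
  apply: (der_le ab dw dGP) => x /rP; exact: le_trans (ler_norm _).
have A2 : - psi t b - - psi t a <= G b - G a.
  apply: (@der_le _ (fun x => - psi t x) G (fun x => - psir t x) dG _ _ ab) => // [x xab|x /rP].
    by apply: derN; exact: dw.
  by apply: le_trans; rewrite -normrN; exact: ler_norm.
have A3 : `|psi t b - psi t a| <= G b - G a by rewrite ler_norml; apply/andP; split; lra.
apply: le_trans A3 _.
have b0 : 0 <= b by lra.
have Mb := mass_le t0 b0; have Ma := mass_prim_ge0 t0 (ltW a0).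
have -> : G b - G a = 2^-1 * (k * (prim (mass t) b - prim (mass t) a)) + L * ((b - a) / a).
  by rewrite /G; field; rewrite gt_eqF.
have : k * (prim (mass t) b - prim (mass t) a) <= e.
  rewrite /k mulrAC ler_pdivrMr; last by rewrite ltr_wpDl.
  rewrite ler_wpM2l ?(ltW e0)// lerBlDr.
  by rewrite (le_trans Mb)// -addrA lerDl addr_ge0.
have : L * ((b - a) / a) <= 2^-1 * e.
  by rewrite mulrC -ler_pdivlMr// ler_pdivrMr.
by lra.
Qed.

(** The quartic term has a favourable sign, and the terms of lower order are the derivative of
    [psi ^ 2 / 2]. *)
Lemma energy_increment_le t a b : 0 < t -> 0 <= a -> a <= b ->
  energy t b - energy t a <=
    2^-1 * (prim (mass t) b - prim (mass t) a) + 2^-1 * (psi t b ^+ 2 - psi t a ^+ 2).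
Proof.
move=> t0 a0 ab.
have -> : 2^-1 * (prim (mass t) b - prim (mass t) a) + 2^-1 * (psi t b ^+ 2 - psi t a ^+ 2)
  = (2^-1 * prim (mass t) b + 2^-1 * psi t b ^+ 2) -
    (2^-1 * prim (mass t) a + 2^-1 * psi t a ^+ 2) by ring.
apply: (@der_le _ (energy t) (fun x => 2^-1 * prim (mass t) x + 2^-1 * psi t x ^+ 2)
  (edens t) (fun x => 2^-1 * mass t x + psi t x * psir t x) _ _ ab) => x /andP[ax _].
- by apply: energy_dr => //; lra.
- have hm : has_der (prim (mass t)) x (mass t x) by apply: mass_der => //; lra.
  have hp : has_der (psi t) x (psir t x) by exact: psi_der.
  by der; rewrite /=; field.
- have x0 : 0 < x by lra.
  have : 0 <= 4^-1 * x ^+ 3 * w t x ^+ 4.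
    by rewrite mulr_ge0 ?exprn_even_ge0// mulr_ge0 ?exprn_ge0 ?(ltW x0).
  have -> : edens t x = 2^-1 * mass t x + psi t x * psir t x - 4^-1 * x ^+ 3 * w t x ^+ 4.
    by rewrite /edens /mass /psi /psir; ring.
  by lra.
Qed.

Lemma energy_bounded : exists C, forall t b, 0 < t -> 0 <= b -> `|energy t b| <= C.
Proof.
pose s := psi_sup.
have s0 : 0 <= s := psi_sup_ge0.
have bd t b : 0 < t -> 0 <= b -> psi t b ^+ 2 <= s ^+ 2.
  move=> t0 b0; rewrite -[psi t b ^+ 2]real_normK ?num_real//.
  by rewrite ler_pXn2r ?nnegrE// psi_le.
exists (2^-1 * (C0 + s ^+ 2) + 4^-1 * s ^+ 2 * (s ^+ 2 + C0)) => t b t0 b0.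
have e0 : energy t 0 = 0 by rewrite /energy prim0.
have psi0 : psi t 0 = 0 by rewrite /psi mul0r.
have M0 := mass_prim_ge0 t0 b0; have M1 := mass_le t0 b0.
have P0 := sqr_ge0 (psi t b); have P1 := bd t b t0 b0.
have s2 := sqr_ge0 s.
have up : energy t b <= 2^-1 * (C0 + s ^+ 2).
  have := energy_increment_le t0 (lexx 0) b0.
  by rewrite e0 prim0 psi0 expr0n /= !subr0; lra.
have lo : 2^-1 * (prim (mass t) b + psi t b ^+ 2) - 4^-1 * s ^+ 2 * (psi t b ^+ 2 + prim (mass t) b)
    <= energy t b.
  pose H x := 2^-1 * (prim (mass t) x + psi t x ^+ 2) - 4^-1 * s ^+ 2 * (psi t x ^+ 2 + prim (mass t) x).
  have H0 : H 0 = 0 by rewrite /H prim0 psi0; ring.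
  have -> : 2^-1 * (prim (mass t) b + psi t b ^+ 2) - 4^-1 * s ^+ 2 * (psi t b ^+ 2 + prim (mass t) b) = H b - H 0.
    by rewrite H0 subr0.
  have -> : energy t b = energy t b - energy t 0 by rewrite e0 subr0.
  apply: (@der_le _ H (energy t) (fun x => 2^-1 * (mass t x + 2 * (psi t x * psir t x))
     - 4^-1 * s ^+ 2 * (2 * (psi t x * psir t x) + mass t x)) (edens t) _ _ b0) => x /andP[x0 xb].
  - have hm : has_der (prim (mass t)) x (mass t x) by apply: mass_der => //; lra.
    have hp : has_der (psi t) x (psir t x) by exact: psi_der.
    by rewrite /H; der; rewrite /=; ring.
  - by apply: energy_dr => //; lra.
  - have -> : edens t x = 2^-1 * mass t x + psi t x * psir t x - 4^-1 * (psi t x ^+ 2 * (x * w t x ^+ 2)).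
      by rewrite /edens /mass /psi /psir; ring.
    have A : psi t x ^+ 2 * (x * w t x ^+ 2) <= s ^+ 2 * (x * w t x ^+ 2).
      by rewrite ler_wpM2r ?bd ?(ltW x0)// mulr_ge0 ?sqr_ge0 ?ltW.
    (* A pointwise Hardy inequality: [x w ^ 2] is the derivative of [psi ^ 2] plus [mass], less two
       squares. *)
    have B : s ^+ 2 * (x * w t x ^+ 2) <= s ^+ 2 * (2 * (psi t x * psir t x) + mass t x).
      rewrite ler_wpM2l//.
      have : 0 <= x * psir t x ^+ 2 + x ^+ 3 * wt t x ^+ 2.
        by rewrite addr_ge0// mulr_ge0 ?sqr_ge0 ?exprn_ge0 ?(ltW x0).
      have -> : 2 * (psi t x * psir t x) + mass t x = x * w t x ^+ 2 + (x * psir t x ^+ 2 + x ^+ 3 * wt t x ^+ 2).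
        by rewrite /mass /psi /psir; ring.
      by lra.
    by lra.
have : 4^-1 * s ^+ 2 * (psi t b ^+ 2 + prim (mass t) b) <= 4^-1 * s ^+ 2 * (s ^+ 2 + C0).
  by rewrite ler_wpM2l ?mulr_ge0//; lra.
have : 0 <= 4^-1 * s ^+ 2 * (s ^+ 2 + C0) by rewrite mulr_ge0 ?(addr_ge0 s2)// mulr_ge0.
by move=> ? ?; rewrite ler_norml; apply/andP; split; lra.
Qed.

(** * Control of [psi] by the energy on a time slice *)

Lemma psi_sq_slice t a b : 0 < t -> 0 < a -> a <= b ->
  (forall x, a < x < b -> `|psi t x| <= 1) ->
  `|psi t b ^+ 2 - psi t a ^+ 2| <= 4 * (energy t b - energy t a).
Proof.
move=> t0 a0 ab ps1.
have dp x : a <= x <= b -> has_der (fun x => psi t x ^+ 2) x (2 * psi t x * psir t x).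
  by move=> _; have hp := psi_der x t0; der; rewrite /=; ring.
have dE x : a <= x <= b -> has_der (fun x => 4 * energy t x) x (4 * edens t x).
  move=> /andP[ax _]; have hE : has_der (energy t) x (edens t x) by apply: energy_dr => //; lra.
  by der; rewrite /=; ring.
have le x : a < x < b -> `|2 * psi t x * psir t x| <= 4 * edens t x.
  by move=> axb; apply: psi_psir_le; [move/andP: axb => []; lra|exact: ps1].
have A : psi t b ^+ 2 - psi t a ^+ 2 <= 4 * energy t b - 4 * energy t a.
  by apply: (der_le ab dp dE) => x /le; exact: le_trans (ler_norm _).
have B : - psi t b ^+ 2 - - psi t a ^+ 2 <= 4 * energy t b - 4 * energy t a.
  apply: (@der_le _ (fun x => - psi t x ^+ 2) _ (fun x => - (2 * psi t x * psir t x)) _ _ _ ab _ dE) => x.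
    by move=> xab; apply: derN; exact: dp.
  by move=> /le; apply: le_trans; rewrite -normrN; exact: ler_norm.
by rewrite ler_norml; apply/andP; split; lra.
Qed.

Lemma energy_mono t a b : 0 < t -> 0 < a -> a <= b ->
  (forall x, a < x < b -> `|psi t x| <= 1) -> energy t a <= energy t b.
Proof.
move=> t0 a0 ab ps1; rewrite -subr_ge0 -(pmulr_rge0 _ (ltr0Sn R 3)).
exact: le_trans (normr_ge0 _) (psi_sq_slice t0 a0 ab ps1).
Qed.

(** By [psi_sq_slice], [psi ^ 2] is at least [psi t r ^ 2 - 4 E] on all of [[a, b]], and the
    integral of [psi ^ 2 / (4 x)] there is at most [E]. As [(b - a) / b >= 1 / 2], this gives
    [(psi t r ^ 2 - 4 E) / 8 <= E]. *)
Lemma psi_sq_le_slice t a b r : 0 < t -> 0 < a -> 2 * a <= b -> a <= r <= b ->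
  (forall x, a < x < b -> `|psi t x| <= 1) ->
  psi t r ^+ 2 <= 12 * (energy t b - energy t a).
Proof.
move=> t0 a0 ab2 /andP[ar rb] ps1; set E := energy t b - energy t a.
have ab : a <= b by lra.
have b0 : 0 < b by lra.
have large x : a < x < b -> psi t r ^+ 2 - 4 * E <= psi t x ^+ 2.
  move=> /andP[ax xb]; have x0 := lt_trans a0 ax; have r0 := lt_le_trans a0 ar.
  have sub y c d : a <= c -> d <= b -> c < y < d -> `|psi t y| <= 1.
    by move=> ac db /andP[cy yd]; apply: ps1; rewrite (le_lt_trans ac)//= (lt_le_trans yd).
  have [xr|/ltW rx] := leP x r.
    have H1 := psi_sq_slice t0 x0 xr (fun y => @sub y _ _ (ltW ax) rb).
    have H2 := energy_mono t0 a0 (ltW ax) (fun y => @sub y _ _ (lexx a) (ltW xb)).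
    have H3 := energy_mono t0 r0 rb (fun y => @sub y _ _ ar (lexx b)).
    by move: H1; rewrite ler_norml => /andP[_]; rewrite /E; lra.
  have H1 := psi_sq_slice t0 r0 rx (fun y => @sub y _ _ ar (ltW xb)).
  have H2 := energy_mono t0 a0 ar (fun y => @sub y _ _ (lexx a) rb).
  have H3 := energy_mono t0 x0 (ltW xb) (fun y => @sub y _ _ (ltW ax) (lexx b)).
  by move: H1; rewrite ler_norml => /andP[+ _]; rewrite /E; lra.
have E0 : 0 <= E by rewrite subr_ge0; exact: energy_mono.
have [neg|pos] := leP (psi t r ^+ 2 - 4 * E) 0; first by lra.
pose c := 4^-1 * (psi t r ^+ 2 - 4 * E) / b.
have c0 : 0 <= c by rewrite divr_ge0 ?(ltW b0)// mulr_ge0// ltW.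
have : c * b - c * a <= E.
  apply: (@der_le _ (fun x => c * x) (energy t) (fun=> c) (edens t) _ _ ab) => x /andP[ax xb].
  - by der; ring.
  - by apply: energy_dr => //; lra.
  - have x0 := lt_trans a0 ax.
    have xin : a < x < b by rewrite ax.
    apply: le_trans (edens_ge_r x0 (ps1 _ xin)).
    rewrite /c -mulrA ler_wpM2l//; apply: ler_pM.
    + exact: ltW.
    + by rewrite invr_ge0 ltW.
    + exact: large.
    + by rewrite lef_pV2// ltW.
rewrite -mulrBr.
have : c * (b / 2) <= c * (b - a) by rewrite ler_wpM2l//; lra.
have -> : c * (b / 2) = 8^-1 * (psi t r ^+ 2 - 4 * E) by rewrite /c; field; rewrite gt_eqF.
by lra.
Qed.

(** * Light cones and smallness of [psi] outside and near them *)

Lemma energy_in_cone_der (t M : R) : 0 < t -> 0 < M - t ->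
  has_der (fun y => energy y (M - y)) t (eflux t (M - t) - edens t (M - t)).
Proof.
move=> t0 Mt.
have -> : (fun y => energy y (M - y)) = (fun y => energy (0 + 1 * y) (M + -1 * y)).
  by apply/funext => y; congr (energy _ _); ring.
have E1 : 0 + 1 * t = t by ring.
have E2 : M + -1 * t = M - t by ring.
have := @energy_line 0 1 M (-1) t; rewrite E1 E2 => /(_ t0 Mt) H.
by apply: der_eq H _; ring.
Qed.

Lemma energy_out_cone_der (t M : R) : 0 < t -> 0 < t + M ->
  has_der (fun y => energy y (y + M)) t (eflux t (t + M) + edens t (t + M)).
Proof.
move=> t0 Mt.
have -> : (fun y => energy y (y + M)) = (fun y => energy (0 + 1 * y) (M + 1 * y)).
  by apply/funext => y; congr (energy _ _); ring.
have E1 : 0 + 1 * t = t by ring.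
have E2 : M + 1 * t = t + M by ring.
have := @energy_line 0 1 M 1 t; rewrite E1 E2 => /(_ t0 Mt) H.
by apply: der_eq H _; ring.
Qed.

Lemma psi_cont : ccont psi.
Proof. by rewrite /psi; ccont_tac. Qed.

(** Compactness provides a first time at which [|psi|] reaches [d] between the two cones. *)
Lemma compact_large_psi (t1 t2 r1 M d : R) : 0 < t1 -> compact [set z : R * R |
  [/\ t1 <= z.1 <= t2, z.1 + r1 <= z.2, z.2 <= M - z.1 & d <= `|psi z.1 z.2|]].
Proof.
move=> t10.
(* Reflecting time at [t1] keeps it positive, so that [psi (tau s) x] is continuous on the whole
   plane. *)
pose tau (s : R) := t1 + `|s - t1|.
have tau0 s : 0 < tau s by rewrite ltr_wpDr.
have tauE s : t1 <= s -> tau s = s by move=> s1; rewrite /tau ger0_norm ?subr_ge0// subrKC.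
have ctau : continuous tau.
  by move=> s; apply: cvgD; [exact: cvg_cst|apply: cvg_norm; apply: cvgB; [exact: cvg_id|exact: cvg_cst]].
pose h1 (z : R * R) := z.2 - z.1 - r1.
pose h2 (z : R * R) := M - z.1 - z.2.
pose h3 (z : R * R) := `|psi (tau z.1) z.2| - d.
have cf : continuous (fst : R * R -> R) by move=> z; exact: cvg_fst.
have cs : continuous (snd : R * R -> R) by move=> z; exact: cvg_snd.
have c1 : continuous h1.
  by move=> z; apply: cvgB; [apply: cvgB; [exact: cs|exact: cf]|exact: cvg_cst].
have c2 : continuous h2.
  by move=> z; apply: cvgB; [apply: cvgB; [exact: cvg_cst|exact: cf]|exact: cs].
have c3 : continuous h3.
  move=> z; have cg1 : (fun z : R * R => tau z.1) @ z --> tau z.1.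
    exact: (continuous_comp (cf z) (ctau z.1)).
  have cg : {for z, continuous (fun z : R * R => (tau z.1, z.2))}.
    exact: (cvg_pair cg1 (cs z)).
  have cp : {for z, continuous (fun z : R * R => psi (tau z.1) z.2)}.
    exact: (continuous_comp cg (@psi_cont _ z.2 (tau0 z.1))).
  by apply: cvgB; [apply: cvg_norm; exact: cp|exact: cvg_cst].
have cl h : continuous h -> closed (h @^-1` [set x : R | 0 <= x]).
  by move=> ch; apply: preimage_closed; [move=> z _; exact: ch|exact: closed_ge].
have -> : [set z : R * R | [/\ t1 <= z.1 <= t2, z.1 + r1 <= z.2, z.2 <= M - z.1 & d <= `|psi z.1 z.2|]]
  = (`[t1, t2] `*` `[t1 + r1, M - t1]) `&` ((h1 @^-1` [set x : R | 0 <= x]) `&`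
      ((h2 @^-1` [set x : R | 0 <= x]) `&` (h3 @^-1` [set x : R | 0 <= x]))).
  apply/seteqP; split => -[s x] /=; rewrite !in_itv/= /h1 /h2 /h3 /= !subr_ge0.
    move=> [/andP[s1 s2] sx xM dx]; rewrite s1 s2 xM; split; split=> //.
    - by apply/andP; split; lra.
    - by lra.
    - by split=> //; rewrite tauE.
  move=> [[/andP[s1 s2] _]] [sx [xM]]; rewrite tauE// => dx.
  by split => //; [rewrite s1|lra].
apply: compact_closedI; first by apply: compact_setX; exact: segment_compact.
by apply: closedI; [exact: cl|apply: closedI; exact: cl].
Qed.

(* The energy outside a light cone does not increase as long as [|psi| <= 1] on
   the cone, so [psi_sq_le_slice] would fail at the first time when [|psi|]
   reaches [d]. *)
Lemma exterior_small (d : R) : 0 < d -> d <= 2^-1 -> exists2 r1, 0 < r1 &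
  forall t r, 1 <= t -> t + r1 <= r -> `|psi t r| < d.
Proof.
(* The contradiction will be [d ^ 2 <= 12 e]. *)
move=> d0 d1; pose e := d ^+ 2 / 32.
have d20 : 0 < d ^+ 2 by rewrite exprn_gt0.
have dd : d ^+ 2 <= d by nra.
have e0 : 0 < e by rewrite divr_gt0.
have ee : e ^+ 2 <= e by rewrite /e; nra.
have [r1 r10 Hr1] := tail_small ltr01 e0.
exists r1 => // t r t1 tr; rewrite ltNge; apply/negP => dr.
(* The incoming cone [x = M - tau] makes the region compact. It contains [(t, r)], and up to time
   [t] its outer radius is at least twice the inner one, as [psi_sq_le_slice] demands. *)
pose M := r + 3 * t + 2 * r1.
have cK := @compact_large_psi 1 t r1 M d ltr01.
set K := (X in compact X) in cK.
have Ktr : K (t, r) by split => //=; [rewrite t1 lexx|rewrite /M; lra].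
have cfK : {within K, continuous (fst : R * R -> R)}.
  by apply: continuous_subspaceT => z; exact: cvg_fst.
have [[ts rs]] := compact_EVT_min (ex_intro _ _ Ktr) cK cfK.
rewrite inE => -[/= /andP[ts1 tst] tsrs rsM drs] Kmin.
have before tau x : 1 <= tau -> tau < ts -> tau + r1 <= x -> x <= M - tau -> `|psi tau x| < d.
  move=> tau1 taut x1 xM; rewrite ltNge; apply/negP => dx.
  have /Kmin : (tau, x) \in K by rewrite inE; split => //=; rewrite tau1; lra.
  by rewrite /= leNgt taut.
have ts1' : 1 < ts.
  rewrite lt_neqAle ts1 andbT; apply/eqP => ts1E.
  have [|H _] := Hr1 rs; first lra.
  by move: H drs; rewrite -ts1E /e => ? ?; nra.
have ts0 : 0 < ts by lra.
have at_ts x : ts + r1 < x < M - ts -> `|psi ts x| <= d.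
  move=> /andP[x1 xM]; apply: (ccont_norm_le_left psi_cont ts0 ts1') => tau tau1 taut.
  by apply: before => //; lra.
(* Both cones let energy only leave the region between them. *)
pose h tau := energy tau (M - tau) - energy tau (tau + r1).
have dh tau : 1 <= tau <= ts -> has_der h tau
    (eflux tau (M - tau) - edens tau (M - tau) - (eflux tau (tau + r1) + edens tau (tau + r1))).
  move=> /andP[? ?]; apply: derB.
    by apply: energy_in_cone_der; rewrite /M; lra.
  by apply: energy_out_cone_der; lra.
have hle : h ts <= h 1.
  rewrite -lerN2; apply: (@der_ge0 _ (fun y => - h y) (fun tau => - (eflux tau (M - tau) - edens tau (M - tau) - (eflux tau (tau + r1) + edens tau (tau + r1))))) => //.
    by move=> tau tau1; apply: derN; exact: dh.
  move=> tau /andP[tau1 taut].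
  have Mtau : tau + r1 <= M - tau by rewrite /M; lra.
  have small1 x : tau + r1 <= x -> x <= M - tau -> `|psi tau x| <= 1.
    move=> x1 x2; have := before tau x (ltW tau1) taut x1 x2.
    by move=> *; lra.
  have tr0 : 0 < tau + r1 by lra.
  have A1 : `|psi tau (M - tau)| <= 1 by apply: small1 => //; lra.
  have A2 : `|psi tau (tau + r1)| <= 1 by apply: small1 => //; lra.
  have [_ F1] := flux_ge0 (lt_le_trans tr0 Mtau) A1.
  have [F2 _] := flux_ge0 tr0 A2.
  by lra.
have h1 : h 1 <= e.
  have le1 : 1 + r1 <= M - 1 by rewrite /M; lra.
  have ge0 : 0 <= 1 + r1 by lra.
  apply: le_trans (energy_increment_le ltr01 ge0 le1) _.
  have [|_ /(_ _ le1) H1] := Hr1 (1 + r1); first lra.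
  have [|H2 _] := Hr1 (M - 1); first lra.
  have : psi 1 (M - 1) ^+ 2 <= e ^+ 2.
    by rewrite -[psi _ _ ^+ 2]real_normK ?num_real// ler_pXn2r ?nnegrE// ltW.
  by have := sqr_ge0 (psi 1 (1 + r1)); lra.
have a0 : 0 < ts + r1 by lra.
have aM : ts + r1 <= M - ts by rewrite /M; lra.
have at1 x : ts + r1 < x < M - ts -> `|psi ts x| <= 1.
  by move=> /at_ts /le_trans; apply; apply: le_trans d1 _; rewrite invf_le1 ?ler1n.
have aM2 : 2 * (ts + r1) <= M - ts by rewrite /M; lra.
have rsin : ts + r1 <= rs <= M - ts by rewrite tsrs.
have := psi_sq_le_slice ts0 a0 aM2 rsin at1; rewrite -/(h ts).
have : d ^+ 2 <= psi ts rs ^+ 2.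
  by rewrite -[psi _ _ ^+ 2]real_normK ?num_real// ler_pXn2r ?nnegrE// ltW.
by rewrite /e in h1; lra.
Qed.

(** From [r = t + r1] inwards to [r = t - r0] the distance is bounded, hence a small fraction of [r]
    when [t] is large, and [psi_holder] applies. *)
Lemma near_cone_small (r0 d : R) : 0 <= r0 -> 0 < d -> exists2 T, 0 < T &
  forall t r, T <= t -> t - r0 <= r -> 0 < r /\ `|psi t r| <= d.
Proof.
move=> r00 d0; pose d' := Num.min (d / 2) 2^-1.
have d'0 : 0 < d' by rewrite lt_min divr_gt0//= invr_gt0.
have d'd : d' <= d / 2 by rewrite ge_min lexx.
have d'2 : d' <= 2^-1 by rewrite ge_min lexx orbT.
have [r1 r10 ext] := exterior_small d'0 d'2.
have d20 : 0 < d / 2 by rewrite divr_gt0.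
have [del del0 hol] := psi_holder d20.
have x0 : 0 <= (r1 + r0) / del by rewrite divr_ge0 ?addr_ge0 ?(ltW r10) ?(ltW del0).
exists (1 + r0 + (r1 + r0) / del); first by lra.
move=> t r tT tr; have rp : 0 < r by lra.
split => //; have [rt|/ltW rt] := leP (t + r1) r.
  by have := ext t r; rewrite rt => /(_ _ isT) H; have := H ltac:(lra); lra.
have t0 : 0 < t by lra.
have rb : t + r1 - r <= del * r.
  apply: (@le_trans _ _ (r1 + r0)); first by lra.
  by rewrite mulrC -ler_pdivrMr//; lra.
have := hol t r (t + r1) t0 rp rt rb.
have := ext t (t + r1); rewrite lexx => /(_ _ isT) H; have := H ltac:(lra).
have := ler_normB (psi t (t + r1)) (psi t (t + r1) - psi t r).
by rewrite opprB addrC subrK; lra.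
Qed.

(** * Null coordinates and propagation of the energy deficit *)

(* The energy in the null coordinates [u = t - r] and [v = t + r]. *)
Definition J (u v : R) := energy (2^-1 * (u + v)) (2^-1 * (v - u)).
Definition J_u (u v : R) :=
  - (2^-1 * (edens (2^-1 * (u + v)) (2^-1 * (v - u)) - eflux (2^-1 * (u + v)) (2^-1 * (v - u)))).
Definition J_v (u v : R) :=
  2^-1 * (edens (2^-1 * (u + v)) (2^-1 * (v - u)) + eflux (2^-1 * (u + v)) (2^-1 * (v - u))).
Definition J_uv (u v : R) := let t := 2^-1 * (u + v) in let r := 2^-1 * (v - u) in
  - (4^-1 * (edens_t t r - eflux_t t r + (edens_r t r - eflux_r t r))).
Definition psi_null (u v : R) := psi (2^-1 * (u + v)) (2^-1 * (v - u)).

Lemma J_energy (t r : R) : J (t - r) (t + r) = energy t r.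
Proof. by rewrite /J; congr (energy _ _); field. Qed.

Lemma psi_nullE (t r : R) : psi_null (t - r) (t + r) = psi t r.
Proof. by rewrite /psi_null; congr (psi _ _); field. Qed.

Lemma J_du (u v : R) : 0 < u + v -> 0 < v - u -> has_der (J ^~ v) u (J_u u v).
Proof.
move=> uv0 vu0; rewrite /J.
have -> : (fun u => energy (2^-1 * (u + v)) (2^-1 * (v - u))) =
    (fun u => energy (2^-1 * v + 2^-1 * u) (2^-1 * v + - 2^-1 * u)).
  by apply/funext => x; congr (energy _ _); ring.
have E1 : 2^-1 * v + 2^-1 * u = 2^-1 * (u + v) by ring.
have E2 : 2^-1 * v + - 2^-1 * u = 2^-1 * (v - u) by ring.
have := @energy_line (2^-1 * v) 2^-1 (2^-1 * v) (- 2^-1) u.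
rewrite E1 E2 => H; apply: der_eq; first by apply: H; rewrite mulr_gt0.
by rewrite /J_u; ring.
Qed.

Lemma J_dv (u v : R) : 0 < u + v -> 0 < v - u -> has_der (J u) v (J_v u v).
Proof.
move=> uv0 vu0; rewrite /J.
have -> : (fun v => energy (2^-1 * (u + v)) (2^-1 * (v - u))) =
    (fun v => energy (2^-1 * u + 2^-1 * v) (- (2^-1 * u) + 2^-1 * v)).
  by apply/funext => x; congr (energy _ _); ring.
have E1 : 2^-1 * u + 2^-1 * v = 2^-1 * (u + v) by ring.
have E2 : - (2^-1 * u) + 2^-1 * v = 2^-1 * (v - u) by ring.
have := @energy_line (2^-1 * u) 2^-1 (- (2^-1 * u)) 2^-1 v.
rewrite E1 E2 => H; apply: der_eq; first by apply: H; rewrite mulr_gt0.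
by rewrite /J_v; ring.
Qed.

Lemma J_u_dv (u v : R) : 0 < u + v -> has_der (J_u u) v (J_uv u v).
Proof.
move=> uv0; rewrite /J_u.
have -> : (fun v => - (2^-1 * (edens (2^-1 * (u + v)) (2^-1 * (v - u)) -
     eflux (2^-1 * (u + v)) (2^-1 * (v - u))))) =
    (fun v => - (2^-1 * (edens (2^-1 * u + 2^-1 * v) (- (2^-1 * u) + 2^-1 * v) -
     eflux (2^-1 * u + 2^-1 * v) (- (2^-1 * u) + 2^-1 * v)))).
  by apply/funext => x; congr (- (_ * (edens _ _ - eflux _ _))); ring.
have E1 : 2^-1 * u + 2^-1 * v = 2^-1 * (u + v) by ring.
have E2 : - (2^-1 * u) + 2^-1 * v = 2^-1 * (v - u) by ring.
have T0 : 0 < 2^-1 * u + 2^-1 * v by rewrite E1 mulr_gt0.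
have Hp := C1_line (- (2^-1 * u)) 2^-1 edens_C1 T0.
have Hq := C1_line (- (2^-1 * u)) 2^-1 eflux_C1 T0.
apply: der_eq; first exact: derN (derM (der_cst _ _) (derB Hp Hq)).
by rewrite E1 E2 /J_uv; field.
Qed.

Lemma J_signs (u v : R) : 0 < u + v -> 0 < v - u -> `|psi_null u v| <= 1 ->
  J_u u v <= 0 /\ 0 <= J_v u v.
Proof.
move=> uv0 vu0 ps1.
have r0 : 0 < 2^-1 * (v - u) by rewrite mulr_gt0.
by have [? ?] := flux_ge0 r0 ps1; rewrite /J_u /J_v; split; lra.
Qed.

(** The weight [s] in [flux_transport_le] is proportional to [v - u], so that the coefficient of
    [J_v] is constant and can be absorbed by a weight linear in [u]. *)
Lemma J_uv_le (u v l : R) : 0 < u + v -> 0 < v - u -> `|psi_null u v| <= 1 -> 0 < l ->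
  `|J_uv u v| <= J_v u v / (2 * l) - 32 * l / (v - u) ^+ 2 * J_u u v.
Proof.
move=> uv0 vu0 ps1 l0.
have r0 : 0 < 2^-1 * (v - u) by rewrite mulr_gt0.
have t0 : 0 < 2^-1 * (u + v) by rewrite mulr_gt0.
have s0 : 0 < (v - u) / (8 * l) by rewrite divr_gt0 ?mulr_gt0.
have := flux_transport_le t0 r0 ps1 s0.
rewrite /J_uv /J_v /J_u /= normrN normrM; set X := `| _ + _|.
set P := edens _ _; set Q := eflux _ _.
have vun0 : v - u != 0 by rewrite gt_eqF.
have ln0 : l != 0 by rewrite gt_eqF.
have -> : 4 / (2^-1 * (v - u)) * ((v - u) / (8 * l) * (P + Q) + ((v - u) / (8 * l))^-1 * (P - Q))
  = 4 * (2^-1 * (P + Q) / (2 * l) - 32 * l / (v - u) ^+ 2 * - (2^-1 * (P - Q))).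
  by field; apply/andP.
by rewrite ger0_norm ?invr_ge0// => H; lra.
Qed.

Lemma J_le_u (u1 u2 v : R) : u1 <= u2 -> 0 < u1 + v -> 0 < v - u2 ->
  (forall u, u1 <= u <= u2 -> `|psi_null u v| <= 1) -> J u2 v <= J u1 v.
Proof.
move=> u12 uv0 vu0 ps1; rewrite -lerN2.
apply: (@der_ge0 _ (fun u => - J u v) (fun u => - J_u u v) _ _ u12) => u /andP[h1 h2].
  by apply: derN; apply: J_du; lra.
have [] : J_u u v <= 0 /\ 0 <= J_v u v.
  by apply: J_signs; [lra|lra|apply: ps1; rewrite !ltW].
by lra.
Qed.

Lemma J_le_v (u v1 v2 : R) : v1 <= v2 -> 0 < u + v1 -> 0 < v1 - u ->
  (forall v, v1 <= v <= v2 -> `|psi_null u v| <= 1) -> J u v1 <= J u v2.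
Proof.
move=> v12 uv0 vu0 ps1.
apply: (@der_ge0 _ (J u) (J_v u) _ _ v12) => v /andP[h1 h2].
  by apply: J_dv; lra.
have [] : J_u u v <= 0 /\ 0 <= J_v u v.
  by apply: J_signs; [lra|lra|apply: ps1; rewrite !ltW].
by [].
Qed.

(* The weight [1 - (u - u1) / 2l - 32 l / (v - u)] is chosen so that the mixed
   derivative of its product with [J - g] is nonpositive: its [u]-slope and its
   [v]-slope absorb the two terms by which [J_uv_le] bounds [J_uv]. *)
Lemma deficit_step (u1 u2 v1 v2 g : R) : u1 < u2 -> v1 <= v2 -> 0 < u1 + v1 ->
  0 < v1 - u2 -> 128 * (u2 - u1) <= v1 - u2 ->
  (forall u v, u1 <= u <= u2 -> v1 <= v <= v2 -> `|psi_null u v| <= 1) ->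
  (forall u v, u1 <= u <= u2 -> v1 <= v <= v2 -> J u v <= g) ->
  4^-1 * (g - J u2 v1) <= g - J u1 v1 + 2^-1 * (g - J u2 v2).
Proof.
move=> u12 v12 uv0 vu0 ratio ps1 Jg.
pose l := u2 - u1; have l0 : 0 < l by rewrite subr_gt0.
have ln0 : l != 0 by rewrite gt_eqF.
pose a u v := 1 - (u - u1) / (2 * l) - 32 * l / (v - u).
pose a_u u v := - (2 * l)^-1 - 32 * l / (v - u) ^+ 2.
pose a_v u v := 32 * l / (v - u) ^+ 2.
pose a_uv u v := 64 * l / (v - u) ^+ 3.
pose W u v := a u v * (J u v - g).
pose W_u u v := a_u u v * (J u v - g) + a u v * J_u u v.
pose W_uv u v := a_uv u v * (J u v - g) + a_u u v * J_v u v +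
  (a_v u v * J_u u v + a u v * J_uv u v).
have pos u v : u1 <= u <= u2 -> v1 <= v <= v2 -> 0 < u + v /\ 0 < v - u.
  by move=> /andP[? ?] /andP[? ?]; split; lra.
(* This is where the constant 128 in [ratio] comes from. *)
have far u v : u1 <= u <= u2 -> v1 <= v <= v2 -> 32 * l / (v - u) <= 4^-1.
  move=> uI vI; have [_ vu] := pos _ _ uI vI.
  rewrite ler_pdivrMr//; move: uI vI => /andP[? ?] /andP[? ?]; rewrite /l; lra.
have far0 u v : u1 <= u <= u2 -> v1 <= v <= v2 -> 0 <= 32 * l / (v - u).
  move=> uI vI; have [_ vu] := pos _ _ uI vI.
  by rewrite divr_ge0 ?mulr_ge0 ?(ltW l0) ?(ltW vu).
have slope u : u1 <= u <= u2 -> 0 <= (u - u1) / (2 * l) <= 2^-1.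
  move=> /andP[? ?]; apply/andP; split.
    by rewrite divr_ge0 ?subr_ge0// mulr_ge0// ltW.
  by rewrite ler_pdivrMr ?mulr_gt0// /l; lra.
have dW u v : u1 <= u <= u2 -> v1 <= v <= v2 -> has_der (W ^~ v) u (W_u u v).
  move=> uI vI; have [uv vu] := pos _ _ uI vI.
  have vun0 : v - u != 0 by rewrite gt_eqF.
  have hJ := J_du uv vu.
  have hd : has_der (fun u => v - u) u (-1) by der; rewrite /=; ring.
  have hV := @derV _ (fun u => v - u) u _ vun0 hd.
  by rewrite /W /a; der; rewrite /W_u /a_u /a; field; rewrite vun0.
have dW_u u v : u1 <= u <= u2 -> v1 <= v <= v2 -> has_der (W_u u) v (W_uv u v).
  move=> uI vI; have [uv vu] := pos _ _ uI vI.
  have vun0 : v - u != 0 by rewrite gt_eqF.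
  have hJ := J_dv uv vu; have hJu := J_u_dv uv.
  have hd : has_der (fun v => v - u) v 1 by der; rewrite /=; ring.
  have hV := @derV _ (fun v => v - u) v _ vun0 hd.
  have hd2 : has_der (fun v => (v - u) ^+ 2) v (2 * (v - u)) by der; rewrite /=; ring.
  have vun2 : (v - u) ^+ 2 != 0 by rewrite expf_neq0.
  have hV2 := @derV _ (fun v => (v - u) ^+ 2) v _ vun2 hd2.
  by rewrite /W_u /a_u /a; der; rewrite /W_uv /a_uv /a_u /a_v /a; field; rewrite vun0.
(* As [|a| <= 1], [J_uv_le] bounds [a J_uv]. Its [J_v] term cancels against the part [- 1 / 2l] of
   [a_u], its [J_u] term against [a_v J_u], and what remains is nonpositive. *)
have Wle u v : u1 <= u <= u2 -> v1 <= v <= v2 -> W_uv u v <= 0.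
  move=> uI vI; have [uv vu] := pos _ _ uI vI.
  have [Ju Jv] := J_signs uv vu (ps1 _ _ uI vI).
  have := J_uv_le uv vu (ps1 _ _ uI vI) l0.
  have Jg0 : a_uv u v * (J u v - g) <= 0.
    rewrite mulr_ge0_le0 ?subr_le0 ?Jg//.
    by apply: divr_ge0; [rewrite mulr_ge0// ltW|rewrite exprn_ge0// ltW].
  have a1 : `|a u v| <= 1.
    have := far _ _ uI vI; have := far0 _ _ uI vI; have /andP[] := slope _ uI.
    by rewrite /a => ? ? ? ?; rewrite ler_norml; apply/andP; split; lra.
  have : a u v * J_uv u v <= `|J_uv u v|.
    by rewrite (le_trans (ler_norm _))// normrM ler_piMl.
  have : 0 <= 32 * l / (v - u) ^+ 2 * J_v u v.
    by rewrite mulr_ge0// divr_ge0 ?sqr_ge0// mulr_ge0// ltW.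
  by rewrite /W_uv /a_u /a_v; lra.
have := rectangle_le0 (ltW u12) v12 dW dW_u Wle.
have u1I : u1 <= u1 <= u2 by rewrite lexx ltW.
have u2I : u1 <= u2 <= u2 by rewrite lexx ltW.
have v1I : v1 <= v1 <= v2 by rewrite lexx.
have v2I : v1 <= v2 <= v2 by rewrite lexx v12.
have aE1 v : a u1 v = 1 - 32 * l / (v - u1) by rewrite /a subrr mul0r subr0.
have aE2 v : a u2 v = 2^-1 - 32 * l / (v - u2).
  by rewrite /a -/l; congr (_ - _); field.
(* At the corners, the weight is at most [1 / 2] at [(u2, v2)], at least [1 / 4] at [(u2, v1)],
   nonnegative at [(u1, v2)] and at most 1 at [(u1, v1)]. *)
have X1 : a u2 v2 * (g - J u2 v2) <= 2^-1 * (g - J u2 v2).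
  by rewrite ler_wpM2r ?subr_ge0 ?Jg// aE2; have := far0 _ _ u2I v2I; lra.
have X0 : 4^-1 * (g - J u2 v1) <= a u2 v1 * (g - J u2 v1).
  by rewrite ler_wpM2r ?subr_ge0 ?Jg// aE2; have := far _ _ u2I v1I; lra.
have Y1 : 0 <= a u1 v2 * (g - J u1 v2).
  apply: mulr_ge0; last by rewrite subr_ge0 Jg.
  by rewrite aE1; have := far _ _ u1I v2I; lra.
have Y0 : a u1 v1 * (g - J u1 v1) <= 1 * (g - J u1 v1).
  by rewrite ler_wpM2r ?subr_ge0 ?Jg// aE1; have := far0 _ _ u1I v1I; lra.
have N u v : W u v = - (a u v * (g - J u v)) by rewrite /W; ring.
by rewrite !N; lra.
Qed.

(** * The limit energy and the induction inwards from the light cone *)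

(* [g] is, up to [e], the energy that remains inside [r < t - r0] as first
   [t] and then [r0] tend to infinity. *)
Lemma limit_energy (e : R) : 0 < e -> exists r0 g V, [/\ 0 <= r0,
  forall v, V <= v -> J r0 v <= g,
  forall v, V <= v -> g - e <= J r0 v &
  forall u V', r0 <= u -> exists2 v, V' <= v & g - e <= J u v].
Proof.
move=> e0; have [C HC] := energy_bounded.
have JC u v : 0 <= u -> u + 1 <= v -> `|J u v| <= C.
  by move=> u0 uv; apply: HC; rewrite ?mulr_gt0 ?mulr_ge0//; lra.
(* The infimum of [X] is the infimum over [u >= 0] of the upper limit of [J u v] as [v] tends to
   infinity. *)
pose X := [set x | exists2 u, 0 <= u & exists V, forall v, V <= v -> J u v <= x].
have infX : has_inf X.
  split.
    exists C, 0 => //; exists 1 => v v1.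
    by apply: le_trans (ler_norm _) (JC 0 v _ _) => //; lra.
  exists (- C) => x [u u0 [V HV]].
  have h1 : V <= `|V| + u + 1 by have := ler_norm V; lra.
  have h2 : u + 1 <= `|V| + u + 1 by have := normr_ge0 V; lra.
  apply: le_trans (HV _ h1).
  by have := JC u _ u0 h2; rewrite ler_norml => /andP[].
have e20 : 0 < e / 2 by lra.
have [g [r0 r00 [V HV]] gX] := inf_adherent e20 infX.
(* Otherwise [inf X - e / 2] would belong to [X]. *)
have often u V' : 0 <= u -> exists2 v, V' <= v & inf X - e / 2 <= J u v.
  move=> u0; apply: contrapT => H.
  have /(ge_inf (proj2 infX)) : X (inf X - e / 2).
    exists u => //; exists V' => v Vv; rewrite leNgt; apply/negP => Jl.
    by apply: H; exists v => //; exact: ltW.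
  by lra.
have [T T0 small] := near_cone_small r00 ltr01.
have [v1 Vv1 Jv1] := often r0 (2 * T + r0 + 1) r00.
exists r0, g, (Num.max V v1); split => //.
- by move=> v; rewrite ge_max => /andP[Vv _]; exact: HV.
(* On the line [u = r0], which stays near the light cone, [J] increases in [v], so a single good
   [v1] suffices. *)
- move=> v; rewrite ge_max => /andP[_ v1v].
  suff : J r0 v1 <= J r0 v by lra.
  apply: J_le_v v1v _ _ _ => [| |x /andP[v1x _]]; [lra|lra|].
  by apply: (small _ _ _ _).2; lra.
- move=> u V' ur0; have [|v V'v Jv] := often u V'; first lra.
  by exists v => //; lra.
Qed.

(** The invariant of the induction inwards. *)
Definition good_point (g d u v : R) : Prop :=
  [/\ 0 < v - u, `|psi_null u v| <= 1, J u v <= g & g - d <= J u v].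

(* Smallness of [psi] propagates inwards from [u <= r0 + k v] to
   [u <= r0 + (k + c) v]: on the time slice through the new point, the energy
   deficit bounds [psi] at the edge of the old region, and [psi] varies little
   from there on. *)
Lemma psi_small_step (r0 g d k c K V T del : R) : 0 <= r0 -> 0 <= k -> 0 <= c ->
  k + c <= K -> K < 1 -> 32 * d <= 1 -> 0 < T -> 0 < del -> 4 * c <= del * (1 - K) ->
  (forall t r, T <= t -> t - r0 <= r -> 0 < r /\ `|psi t r| <= 4^-1) ->
  (forall t a b, 0 < t -> 0 < a -> a <= b -> b - a <= del * a ->
     `|psi t b - psi t a| <= 2^-1) ->
  (forall u v, V <= v -> r0 <= u -> u <= r0 + k * v -> good_point g d u v) ->
  forall u v, V <= v -> 2 * T <= v -> 2 * r0 <= (1 - K) * v ->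
    r0 <= u -> u <= r0 + (k + c) * v ->
  2^-1 * (1 - K) * v <= v - u /\ `|psi_null u v| <= 1.
Proof.
move=> r00 k0 c0 kcK K1 d1 T0 del0 cdel near hol IH u v Vv Tv rv ru uv.
have v0 : 0 < v by lra.
have kcv : (k + c) * v <= K * v by rewrite ler_wpM2r// ltW.
have vu : 2^-1 * (1 - K) * v <= v - u by lra.
split => //.
have [uk|/ltW uk] := leP u (r0 + k * v); first by have [] := IH u v Vv ru uk.
pose t := 2^-1 * (u + v); pose r := 2^-1 * (v - u).
have tE : 2 * t = u + v by rewrite /t; field.
have rE : r = v - t by rewrite /t /r; field.
have t0 : 0 < t by rewrite /t; lra.
have r0' : 0 < r.
  have : 0 < (1 - K) * v by rewrite mulr_gt0 ?subr_gt0.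
  by rewrite /r; lra.
clear kcK K1 rv kcv T0.
(* The slice at time [t] meets the edge [u = r0 + k v] of the old region at [v = v2]. *)
pose v2 := (2 * t - r0) / (1 + k).
have k10 : 0 < 1 + k by lra.
have v2E : (1 + k) * v2 = 2 * t - r0 by rewrite /v2; field; rewrite gt_eqF.
have vv2 : v <= v2 by rewrite -(ler_pM2l k10) v2E tE; lra.
have v2v : v2 - v <= c * v.
  rewrite -(ler_pM2l k10) mulrBr v2E tE.
  have : 0 <= k * (c * v) by rewrite mulr_ge0// mulr_ge0// ltW.
  by lra.
clear uk uv c0.
pose r2 := v2 - t.
have rr2 : r <= r2 by rewrite rE /r2; lra.
have r20 : 0 < r2 by lra.
have kv2 : 0 <= k * v2 by rewrite mulr_ge0//; lra.
have r2t : r2 <= t - r0 by rewrite /r2; lra.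
have slice x : r2 <= x -> x <= t - r0 -> good_point g d (t - x) (t + x).
  move=> r2x xt; have v2x : v2 <= t + x by rewrite /r2 in r2x; lra.
  have : k * v2 <= k * (t + x) by rewrite ler_wpM2l.
  by move=> kx; apply: IH; rewrite /r2 in r2x; lra.
clear Vv vv2 k0.
have ps1 x : r2 < x < t - r0 -> `|psi t x| <= 1.
  move=> /andP[xr xt]; have [_ + _ _] := slice x (ltW xr) (ltW xt).
  by rewrite psi_nullE.
have H1 := psi_sq_slice t0 r20 r2t ps1.
have [_ _ _] := slice r2 (lexx r2) r2t; rewrite J_energy => H2.
have [_ _ + _] := slice (t - r0) r2t (lexx _); rewrite J_energy => H3.
have [|_ H4] := near t (t - r0) _ (lexx _); first by lra.
clear Tv ru tE.
have H5 : psi t (t - r0) ^+ 2 <= 4^-1 ^+ 2.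
  by rewrite -[psi _ _ ^+ 2]real_normK ?num_real// ler_pXn2r ?nnegrE.
(* The two contributions to [psi ^ 2] are [1 / 16] from the cone and [4 d <= 1 / 8] from the
   deficit. *)
have H6 : `|psi t r2| <= 2^-1.
  rewrite -(@ler_pXn2r _ 2) ?nnegrE// real_normK ?num_real//.
  by move: H1; rewrite ler_norml => /andP[+ _]; move: H5; rewrite !expr2; lra.
clear H1 H2 H3 H4 H5 d1.
have H7 : `|psi t r2 - psi t r| <= 2^-1.
  apply: hol => //; apply: (@le_trans _ _ (c * v)); first by rewrite rE /r2; lra.
  have : del * (4^-1 * (1 - K) * v) <= del * r by rewrite ler_wpM2l ?(ltW del0)// /r; lra.
  apply: le_trans; have : 4 * c * v <= del * (1 - K) * v by rewrite ler_wpM2r// ltW.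
  by lra.
rewrite /psi_null -/t -/r.
have -> : psi t r = psi t r2 - (psi t r2 - psi t r) by ring.
by apply: le_trans (ler_normB _ _) _; lra.
Qed.

(** [psi_small_step] gives [|psi| <= 1] on the larger region. This makes [J] monotone in [u], hence
    at most [g], and permits [deficit_step] between the old edge and the new point. *)
Lemma energy_chain_step (r0 g d d1 k c K V V0 T del : R) : 0 <= r0 -> 0 <= k -> 0 <= c ->
  k + c <= K -> K < 1 -> 0 <= d1 -> d1 <= d -> 32 * d <= 1 -> 0 < T -> 0 < del ->
  4 * c <= del * (1 - K) -> 256 * c <= 1 - K ->
  (forall t r, T <= t -> t - r0 <= r -> 0 < r /\ `|psi t r| <= 4^-1) ->
  (forall t a b, 0 < t -> 0 < a -> a <= b -> b - a <= del * a ->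
     `|psi t b - psi t a| <= 2^-1) ->
  (forall v, V0 <= v -> J r0 v <= g) ->
  (forall u V', r0 <= u -> exists2 v, V' <= v & g - d1 <= J u v) ->
  (forall u v, V <= v -> r0 <= u -> u <= r0 + k * v -> good_point g d u v) ->
  exists V', forall u v, V' <= v -> r0 <= u -> u <= r0 + (k + c) * v ->
    good_point g (8 * d) u v.
Proof.
move=> r00 k0 c0 kcK K1 d10 d1d d32 T0 del0 cdel c256 near hol V0g far IH.
have step := psi_small_step r00 k0 c0 kcK K1 d32 T0 del0 cdel near hol IH.
have K10 : 0 < 1 - K by rewrite subr_gt0.
have kc0 : 0 <= k + c by exact: addr_ge0.
clear near hol kcK K1 d32 del0 cdel.
exists (Num.max (Num.max V V0) (Num.max (2 * T) (2 * r0 / (1 - K)))).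
set V' := Num.max _ _.
have V'P x : V' <= x -> [/\ V <= x, V0 <= x, 2 * T <= x & 2 * r0 <= (1 - K) * x].
  rewrite !ge_max => /andP[/andP[-> ->] /andP[-> H]]; split=> //.
  by rewrite [leRHS]mulrC -ler_pdivrMr.
have pos b : V' <= b -> 0 < b.
  by move=> /V'P[_ _ + _]; apply: lt_le_trans; rewrite mulr_gt0.
have small a b : V' <= b -> r0 <= a -> a <= r0 + (k + c) * b ->
    2^-1 * (1 - K) * b <= b - a /\ `|psi_null a b| <= 1.
  by move=> /V'P[? ? ? ?]; exact: step.
have gap b : V' <= b -> 0 < 2^-1 * (1 - K) * b.
  by move=> /pos b0; rewrite mulr_gt0// mulr_gt0.
clear step.
have Jg a b : V' <= b -> r0 <= a -> a <= r0 + (k + c) * b -> J a b <= g.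
  move=> V'b ra ab; have [_ V0b _ _] := V'P _ V'b.
  have [ba _] := small a b V'b ra ab.
  apply: le_trans (V0g _ V0b); apply: J_le_u ra _ _ _.
  - by rewrite ltr_wpDl// pos.
  - exact: lt_le_trans (gap _ V'b) ba.
  - move=> x /andP[rx xa]; apply: (small x b V'b rx _).2.
    exact: le_trans ab.
move=> u v V'v ru uv; have [Vv _ _ _] := V'P _ V'v; have v0 := pos _ V'v.
have [vu psiuv] := small u v V'v ru uv.
have vu0 := lt_le_trans (gap _ V'v) vu.
split; [exact: vu0|exact: psiuv|exact: Jg|].
clear V0g V'P.
have kv : 0 <= k * v by rewrite mulr_ge0// ltW.
have [uk|uk] := leP u (r0 + k * v).
  have [_ _ _] := IH u v Vv ru uk; apply: le_trans; rewrite lerD2l lerN2.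
  by rewrite ler_peMl ?ler1n// (le_trans d10).
(* The far side of the rectangle: a late [v2] at which the deficit on the line through [u] is at
   most [d1]. *)
have [v2 vv2 Jv2] := far u v ru.
have ru1 : r0 <= r0 + k * v by rewrite lerDl.
have [_ _ _ H1] := IH _ v Vv ru1 (lexx _).
have region a b : r0 + k * v <= a <= u -> v <= b <= v2 ->
    [/\ V' <= b, r0 <= a & a <= r0 + (k + c) * b].
  move=> /andP[ua au] /andP[vb bv]; split.
  - exact: le_trans vb.
  - exact: le_trans ua.
  - by apply: (le_trans au); apply: (le_trans uv); rewrite lerD2l ler_wpM2l.
have A1 : 0 < r0 + k * v + v by rewrite ltr_wpDl// addr_ge0.
have A3 : 128 * (u - (r0 + k * v)) <= v - u.
  have : 256 * c * v <= (1 - K) * v by rewrite ler_wpM2r// ltW.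
  by clear vu0 ru A1 ru1 kv v0 c256; lra.
have A4 a b : r0 + k * v <= a <= u -> v <= b <= v2 -> `|psi_null a b| <= 1.
  by move=> aI bI; have [? ? ?] := region a b aI bI; apply: (small a b _ _ _).2.
have A5 a b : r0 + k * v <= a <= u -> v <= b <= v2 -> J a b <= g.
  by move=> aI bI; have [? ? ?] := region a b aI bI; apply: Jg.
(* The new deficit is at most [4 (d + d1 / 2) <= 6 d]. *)
have := deficit_step uk vv2 A1 vu0 A3 A4 A5.
by clear uv vu uk ru ru1 A1 A3 kv vv2 c256; lra.
Qed.

(** The number of steps depends on [K] and [del] alone, so the initial deficit can be fixed in
    advance to allow for all the losses. *)
Lemma energy_chain (K e : R) : 0 <= K -> K < 1 -> 0 < e -> exists r0 g V, 0 <= r0 /\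
  forall u v, V <= v -> r0 <= u -> u <= r0 + K * v -> good_point g e u v.
Proof.
move=> K0 K1 e0; have h0 : 0 < (2^-1 : R) by [].
have [del del0 hol] := psi_holder h0.
have K10 : 0 < 1 - K by rewrite subr_gt0.
(* With [c = K / N] and [N > Q], both bounds on [c] in [energy_chain_step] follow from
   [c Q <= 1]. *)
pose Q := (4 / del + 256) / (1 - K).
have Q0 : 0 <= Q.
  exact: (divr_ge0 (addr_ge0 (divr_ge0 (ler0n R 4) (ltW del0)) (ler0n R 256)) (ltW K10)).
have QN := archi_boundP Q0; set N := Num.bound Q in QN.
have N0 : 0 < N%:R :> R by exact: le_lt_trans QN.
pose c := K / N%:R.
have c0 : 0 <= c by rewrite divr_ge0// ltW.
have cQ : c * Q <= 1.
  rewrite /c mulrAC ler_pdivrMr// mul1r.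
  apply: (@le_trans _ _ (1 * Q)); last by rewrite mul1r ltW.
  by rewrite ler_wpM2r// ltW.
have cQ' : c * (4 / del + 256) <= 1 - K.
  by move: cQ; rewrite /Q mulrA ler_pdivrMr// mul1r.
have cdel0 : 0 <= c * (4 / del) by rewrite mulr_ge0// divr_ge0// ltW.
have c256 : 256 * c <= 1 - K by move: cQ'; rewrite mulrDr; lra.
have cdel : 4 * c <= del * (1 - K).
  rewrite [leRHS]mulrC -ler_pdivrMr//.
  by have -> : 4 * c / del = c * (4 / del) by [ring|]; move: cQ'; rewrite mulrDr; lra.
(* Each step costs a factor 8; the deficit must end below [e] and stay below [1 / 32] throughout. *)
pose e1 := Num.min e 32^-1 / 8 ^+ N.
have pow0 n : 0 < 8 ^+ n :> R by rewrite exprn_gt0.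
have m0 : 0 < Num.min e 32^-1 by rewrite lt_min e0 invr_gt0 ltr0n.
have e10 : 0 < e1 by rewrite divr_gt0.
have e1N : 8 ^+ N * e1 = Num.min e 32^-1 by rewrite /e1; field; rewrite gt_eqF.
have [r0 [g [V0 [r00 V0g V0l far]]]] := limit_energy e10.
have q0 : 0 < (4^-1 : R) by [].
have [T T0 near] := near_cone_small r00 q0.
have main k : (k <= N)%N -> exists V, forall u v, V <= v -> r0 <= u ->
    u <= r0 + k%:R * c * v -> good_point g (8 ^+ k * e1) u v.
  elim: k => [_|k IH kN].
    exists (Num.max V0 (2 * T + r0 + 1)) => u v; rewrite ge_max => /andP[V0v Tv].
    rewrite mul0r mul0r addr0 expr0 mul1r => ru ur.
    have -> : u = r0 by apply: le_anti; rewrite ru ur.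
    split; [by lra| |exact: V0g|exact: V0l].
    have [||_] := near (2^-1 * (r0 + v)) (2^-1 * (v - r0)); [lra|lra|].
    by rewrite /psi_null => H; apply: le_trans H _; lra.
  have [V HV] := IH (ltnW kN).
  have kc0 : 0 <= k%:R * c by rewrite mulr_ge0.
  have kcE : k%:R * c + c = k.+1%:R * c by rewrite -natr1 mulrDl mul1r.
  have kcK : k%:R * c + c <= K.
    by rewrite kcE /c mulrA ler_pdivrMr// mulrC ler_wpM2l// ler_nat.
  have dk : 32 * (8 ^+ k * e1) <= 1.
    rewrite mulrC -ler_pdivlMr// mul1r.
    apply: (@le_trans _ _ (8 ^+ N * e1)); last by rewrite e1N ge_min lexx orbT.
    by rewrite ler_wpM2r ?(ltW e10)// ler_weXn2l ?ler1n// ltnW.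
  have ke : e1 <= 8 ^+ k * e1 by rewrite ler_peMl ?(ltW e10)// exprn_ege1// ler1n.
  have [V' HV'] := energy_chain_step r00 kc0 c0 kcK K1 (ltW e10) ke dk T0 del0 cdel c256
    near hol V0g far HV.
  by exists V' => u v V'v ru uv; rewrite exprS -mulrA; apply: HV' => //; rewrite kcE.
have [V HV] := main N (leqnn N).
exists r0, g, V; split => // u v Vv ru uv.
have NcK : N%:R * c = K by rewrite /c; field; rewrite gt_eqF.
have [|? ? ? H] := HV u v Vv ru; first by rewrite NcK.
split => //; apply: le_trans H; rewrite e1N lerD2l lerN2.
by rewrite ge_min lexx.
Qed.

Lemma energy_vanishes (lam e : R) : 0 < lam < 1 -> 0 < e -> exists r0,
  forall rho, r0 <= rho -> exists2 T, 0 < T & forall t, T <= t ->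
    lam * t <= t - rho ->
    energy t (t - rho) - energy t (lam * t) <= e /\
    forall r, lam * t <= r <= t - rho -> 0 < r /\ `|psi t r| <= 1.
Proof.
move=> /andP[lam0 lam1] e0.
have l10 : 0 < 1 + lam by lra.
(* In null coordinates the line [r = lam t] is [u = K v]. *)
pose K := (1 - lam) / (1 + lam).
have K0 : 0 <= K by rewrite divr_ge0 ?subr_ge0 ?ltW.
have K1 : K < 1 by rewrite ltr_pdivrMr//; lra.
have KE : K * (1 + lam) = 1 - lam by rewrite /K; field; rewrite gt_eqF.
have [r0 [g [V [r00 HV]]]] := energy_chain K0 K1 e0.
exists r0 => rho rrho; exists (`|V| + 1) => [|t tT lt].
  by have := normr_ge0 V; lra.
have tV : V <= t by have := ler_norm V; lra.
have t0 : 0 < t by have := normr_ge0 V; lra.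
have lt0 : 0 < lam * t by rewrite mulr_gt0.
have pt r : lam * t <= r -> r <= t - rho -> good_point g e (t - r) (t + r).
  move=> lr rt; apply: HV; [by lra|by lra|].
  have : K * ((1 + lam) * t) <= K * (t + r) by rewrite ler_wpM2l//; lra.
  by rewrite mulrA KE; lra.
split => [|r /andP[lr rt]].
  have [_ _ _] := pt (lam * t) (lexx _) lt; rewrite J_energy => H1.
  have [_ _ + _] := pt (t - rho) lt (lexx _); rewrite J_energy => H2.
  by lra.
have [+ + _ _] := pt r lr rt; rewrite psi_nullE => ? ?.
by split => //; lra.
Qed.

End Wave.

(** * Smooth radial profiles *)

Section Profile.
Context {R : realType}.
Local Notation V := (R^o * 'rV[R]_4)%type.

Definition ray : 'rV[R]_4 := delta_mx ord0 ord0.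
(** Restricted to this plane, [radial_lift u] becomes [u t |r|], whose derivatives are directional
    derivatives of the lift. *)
Definition plane (t r : R) : V := (t, r *: ray).

Lemma plane_cont : continuous (fun z : R * R => plane z.1 z.2).
Proof.
move=> z.
have cs : (fun z : R * R => z.2 *: ray) @ z --> z.2 *: ray.
  by apply: cvgZr_tmp; exact: cvg_snd.
exact: (cvg_pair (cvg_fst : (fun z : R * R => z.1) @ z --> z.1) cs).
Qed.

Lemma C_on_ccont n (O : set V) (f : V -> R) : (forall t r, 0 < t -> O (plane t r)) ->
  C_on n O f -> ccont (fun t r => f (plane t r)).
Proof.
move=> OP; case: n => [|n] [cf _] t r t0;
  exact: (continuous_comp (@plane_cont (t, r)) (cf _ (OP t r t0))).
Qed.

Lemma line_der (f : V -> R) (z v : V) (g : R -> R) (x : R) :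
  derivable (f : V -> R^o) z v -> (forall h, g (x + h) = f (h *: v + z)) ->
  has_der g x (derive (f : V -> R^o) z v).
Proof.
move=> df gE.
have E : (fun h : R => h^-1 *: (g (h *: 1 + x) - g x)) =
    (fun h : R => h^-1 *: ((f : V -> R^o) (h *: v + z) - (f : V -> R^o) z)).
  apply/funext => h; have -> : g x = f z by have := gE 0; rewrite addr0 scale0r add0r.
  have -> : h *: 1 + x = x + h by rewrite [_ *: 1]mulr1 addrC.
  by rewrite gE.
by apply: DeriveDef; rewrite /derivable /derive /= E.
Qed.

Lemma C_on_C1 n (O : set V) (f : V -> R) : (forall t r, 0 < t -> O (plane t r)) ->
  C_on n.+1 O f -> C1 (fun t r => f (plane t r))
    (fun t r => derive (f : V -> R^o) (plane t r) (1, 0))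
    (fun t r => derive (f : V -> R^o) (plane t r) (0, ray)).
Proof.
move=> OP [cf df]; split.
- move=> t r t0; apply: line_der; first exact: (df _).1 _ (OP t r t0).
  move=> h; congr f; rewrite /plane; congr pair; last by rewrite /= scaler0 add0r.
  by rewrite /= addrC [_ *: 1]mulr1.
- move=> t r t0; apply: line_der; first exact: (df _).1 _ (OP t r t0).
  move=> h; congr f; rewrite /plane; congr pair; last by rewrite /= addrC scalerDl.
  by rewrite /= scaler0 add0r.
- exact: C_on_ccont OP (df _).2.
- exact: C_on_ccont OP (df _).2.
Qed.

Lemma euclid_norm_ray (r : R) : euclid_norm (r *: ray) = `|r|.
Proof.
rewrite /euclid_norm (bigD1 ord0)//= big1 ?addr0.
  by rewrite !mxE eqxx mulr1 sqrtr_sqr.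
by move=> i i0; rewrite !mxE (negbTE i0) andbF mulr0 expr0n.
Qed.

(* The even extension of the profile is smooth across [r = 0]. *)
Lemma smooth_profile (u : R -> R -> R) :
  smooth_on [set z : V | `[0, +oo[%classic z.1] (radial_lift u) ->
  exists w wt wr wtt wtr wrt wrr : R -> R -> R,
    [/\ forall t r, w t r = u t `|r|, ccont w, C1 w wt wr, C1 wt wtt wtr & C1 wr wrt wrr].
Proof.
move=> [U [_ UA smooth]].
have OP (t r : R) : 0 < t -> U (plane t r).
  by move=> t0; apply: UA; rewrite /= in_itv/= andbT ltW.
have s2 := smooth 2.
have s1 v : C_on 1 U (fun z : V => derive (radial_lift u : V -> R^o) z v) := (s2.2 v).2.
have cw := C_on_C1 OP s2.
have cwt := C_on_C1 OP (s1 (1, 0)).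
have cwr := C_on_C1 OP (s1 (0, ray)).
do 7 eexists; split; [|exact: C_on_ccont OP s2|exact: cw|exact: cwt|exact: cwr].
by move=> t r; rewrite /radial_lift /= euclid_norm_ray.
Qed.

End Profile.

(** * Lebesgue integrals and upper limits *)

Section Integrals.
Context {R : realType}.

Lemma integral_cc_eq (f : R -> R) (F : R -> R) (a b : R) : a <= b -> continuous f ->
  (forall x, a <= x <= b -> has_der F x (f x)) ->
  (\int[lebesgue_measure]_(x in `[a, b]) (f x)%:E = (F b - F a)%:E)%E.
Proof.
rewrite le_eqVlt => /predU1P[<-|ab] cf dF.
  by rewrite set_itv1 integral_set1 subrr.
rewrite (@continuous_FTC2 _ f F a b ab) ?EFinB//.
- exact: continuous_subspaceT.
- split.
  + by move=> x xab; have [] := dF x; rewrite ?(itvP xab).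
  + by apply: cvg_at_right_filter; apply: (der_cont (dF a _)); rewrite lexx ltW.
  + by apply: cvg_at_left_filter; apply: (der_cont (dF b _)); rewrite lexx ltW.
- move=> x xab; have [dx <-] : has_der F x (f x) by apply: dF; rewrite !ltW ?(itvP xab).
  by rewrite derive1E.
Qed.

Lemma continuous_measurable_on (f : R -> R) (D : set R) : measurable D -> continuous f ->
  measurable_fun D f.
Proof. by move=> mD cf; apply: measurable_funTS; exact: continuous_measurable_fun. Qed.

Lemma prim_le_integral (f : R -> R) (b : R) : continuous f ->
  (forall x, 0 < x -> 0 <= f x) -> 0 <= b ->
  ((prim f b)%:E <= \int[lebesgue_measure]_(x in `]0%R, +oo[) (f x)%:E)%E.
Proof.
move=> cf f0 b0.
have dp x : 0 <= x <= b -> has_der (prim f) x (f x).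
  by move=> /andP[x0 _]; apply: der_prim => //; lra.
rewrite -[prim f b]subr0 -{1}(prim0 f) -(integral_cc_eq b0 cf dp).
rewrite -integral_itv_obnd_cbnd; last by apply/measurable_EFinP; exact: continuous_measurable_on.
apply: ge0_subset_integral => //.
- by apply/measurable_EFinP; exact: continuous_measurable_on.
- by move=> x /=; rewrite in_itv/= andbT lee_fin => /f0.
- by apply: subset_itvl; rewrite bnd_simp.
Qed.

Lemma not_bounded_below_by_cst (f : R -> R) (B c : R) : continuous f -> 0 < c -> 0 <= B ->
  (forall x, 0 < x -> 0 <= f x) -> (forall x, B < x -> c <= f x) ->
  (\int[lebesgue_measure]_(x in `]0%R, +oo[) (f x)%:E = +oo)%E.
Proof.
move=> cf c0 B0 f0 fc; apply/eqP; rewrite eq_le leey /=.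
have -> : (+oo = \int[lebesgue_measure]_(x in `]B, +oo[) (cst c%:E x) :> \bar R)%E.
  by rewrite integral_cst//= lebesgue_measure_itv/= ltry addye// gt0_muley// lte_fin.
apply: (@le_trans _ _ (\int[lebesgue_measure]_(x in `]B, +oo[) (f x)%:E)%E).
  apply: ge0_le_integral => //=.
  - by move=> x _; rewrite lee_fin ltW.
  - by apply/measurable_EFinP; exact: continuous_measurable_on.
  - by move=> x; rewrite in_itv/= andbT lee_fin => /fc.
apply: ge0_subset_integral => //.
- by apply/measurable_EFinP; exact: continuous_measurable_on.
- by move=> x /=; rewrite in_itv/= andbT lee_fin => /f0.
- by apply: subset_itvr; rewrite bnd_simp.
Qed.

Lemma limf_esup_pinfty_le (f : R -> \bar R) (T : R) (e : \bar R) :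
  (forall t, T <= t -> (f t <= e)%E) -> (limf_esup f (pinfty_nbhs R) <= e)%E.
Proof.
move=> H; rewrite limf_esupE.
apply: (@le_trans _ _ (ereal_sup (f @` [set t | T < t]))).
  apply: ereal_inf_lbound; exists [set t | T < t] => //.
  by exists T; split => //; exact: num_real.
by apply: ge_ereal_sup => _ [t /= Tt <-]; apply: H; exact: ltW.
Qed.

Lemma limf_esup_pinfty_ge (f : R -> \bar R) (e : \bar R) :
  (forall t, 0 < t -> (e <= f t)%E) -> (e <= limf_esup f (pinfty_nbhs R))%E.
Proof.
move=> H; rewrite limf_esupE; apply: le_ereal_inf_tmp => _ [A [M [_ MA]] <-].
pose t := `|M| + 1.
have t0 : 0 < t by rewrite ltr_wpDl.
apply: le_trans (H _ t0) _; apply: ereal_sup_ubound; exists t => //.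
by apply: MA; rewrite (le_lt_trans (ler_norm _))// ltrDl.
Qed.

End Integrals.

Section HnormBound.
Context {R : realType}.

Lemma radial_int_le_Hnorm (f g : R -> R) (S : \bar R) : (Hnorm f g <= S)%E ->
  (radial_int (fun r => (derive1 f r ^+ 2 + g r ^+ 2)%R) <= poweR S 2)%E.
Proof.
move=> HS.
have x0 : (0 <= radial_int (fun r => (derive1 f r ^+ 2 + g r ^+ 2)%R))%E.
  apply: integral_ge0 => r /=; rewrite in_itv/= andbT => r0; rewrite lee_fin.
  by rewrite mulr_ge0 ?addr_ge0 ?sqr_ge0// exprn_ge0// ltW.
have H0 : (0 <= Hnorm f g)%E by exact: poweR_ge0.
have -> : radial_int (fun r => (derive1 f r ^+ 2 + g r ^+ 2)%R) = poweR (Hnorm f g) 2.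
  by rewrite /Hnorm -poweRrM mulVf ?pnatr_eq0// poweRe1.
apply: gt0_ler_poweR => //; rewrite in_itv/= leey andbT//.
exact: le_trans HS.
Qed.

End HnormBound.

(** * From the energy of [w] to the local energy of [u] *)

Theorem theorem4p4 (R : realType) (u : R -> R -> R) (lambda : R)
    (hsol : smooth_finite_energy_solution `[0, +oo[ u)
    (hbdd : (ereal_sup [set Hnorm (u t) (dt u t) | t in `[0%R, +oo[] < +oo)%E)
    (hlambda : 0 < lambda < 1) :
  limf_esup (fun t : R => local_energy u t (lambda * t) (t - rho))
      (pinfty_nbhs R) @[rho --> +oo] --> 0%E.
Proof.
have [w [wt [wr [wtt [wtr [wrt [wrr [wu cw Cw Cwt Cwr]]]]]]]] :=
  smooth_profile (sol_smooth hsol).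
have wE t r : 0 <= r -> u t r = w t r by move=> r0; rewrite wu ger0_norm.
have It (t : R) : 0 < t -> `[0, +oo[%classic t by move=> t0; rewrite /= in_itv/= andbT ltW.
have near_pos (x : R) : 0 < x -> \forall y \near x, 0 < y.
  by move=> x0; exact: (@cvgr_gt _ _ (nbhs x) _ id x cvg_id 0 x0).
have dtE t r : 0 < t -> 0 <= r -> dt u t r = wt t r.
  move=> t0 r0; rewrite /dt derive1E; have [_ <-] := C1_t Cw r t0.
  by congr ('D_1 _ t); apply/funext => s; rewrite wE.
(* At [r = 0] the derivative would involve negative radii, where [u] is arbitrary; hence [r > 0]. *)
have drE t r : 0 < t -> 0 < r -> dr u t r = wr t r.
  move=> t0 r0; rewrite /dr derive1E; have [_ <-] := C1_r Cw r t0.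
  apply: near_eq_derive; near=> x; rewrite wE// ltW//.
  by near: x; exact: near_pos.
have dttE t r : 0 < t -> 0 < r -> dt (dt u) t r = wtt t r.
  move=> t0 r0; rewrite {1}/dt derive1E; have [_ <-] := C1_t Cwt r t0.
  apply: near_eq_derive; near=> s; rewrite dtE ?ltW//.
  by near: s; exact: near_pos.
have drrE t r : 0 < t -> 0 < r -> dr (dr u) t r = wrr t r.
  move=> t0 r0; rewrite {1}/dr derive1E; have [_ <-] := C1_r Cwr r t0.
  apply: near_eq_derive; near=> x; rewrite drE//.
  by near: x; exact: near_pos.
have weq t r : 0 < t -> 0 < r -> wtt t r = wrr t r + 3 / r * wr t r + w t r ^+ 3.
  move=> t0 r0; have := sol_eq hsol (It t t0) r0.
  by rewrite dttE// drrE// drE// wE ?ltW// => E; lra.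
have cwt := C1_ct Cw; have cwr := C1_cr Cw.
have cmass : ccont (mass wt wr) by rewrite /mass; ccont_tac.
set S := ereal_sup _ in hbdd.
have S0 : (0 <= S)%E.
  apply: (@le_trans _ _ (Hnorm (u 1) (dt u 1))); first exact: poweR_ge0.
  by apply: ereal_sup_ubound; exists 1 => //; exact: It.
pose C0 := fine (poweR S 2).
have C00 : 0 <= C0 by rewrite fine_ge0// poweR_ge0.
have C0E : poweR S 2 = C0%:E.
  by rewrite fineK// ge0_fin_numE ?poweR_ge0// poweR_lty.
have mass_le t b : 0 < t -> 0 <= b -> prim (mass wt wr t) b <= C0.
  move=> t0 b0; rewrite -lee_fin -C0E.
  have HS : (Hnorm (u t) (dt u t) <= S)%E.
    by apply: ereal_sup_ubound; exists t => //; exact: It.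
  apply: le_trans (radial_int_le_Hnorm HS).
  apply: le_trans (prim_le_integral (ccont_slice cmass t0) _ b0) _.
    by move=> x x0; apply: mass_ge0; exact: ltW.
  rewrite le_eqVlt; apply/orP; left; apply/eqP; apply: eq_integral => r.
  rewrite inE /= in_itv/= andbT => r0; congr EFin.
  rewrite -/(dr u t r) drE// dtE ?ltW// /mass; ring.
have vanish t b e : 0 < t -> 0 < e -> exists2 b' : R, b < b' & `|w t b'| < e.
  move=> t0 e0; apply: contrapT => H.
  (* If [|w| >= e] beyond [b], the integral of [u ^ 4] over space would be infinite. *)
  have [_] := sol_H hsol (It t t0); rewrite /radial_int.
  have cf : ccont (fun t r => w t r ^+ 4 * r ^+ 3) by ccont_tac.
  have -> : (\int[lebesgue_measure]_(r in `]0%R, +oo[) (`|u t r| ^+ 4 * r ^+ 3)%:E =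
      \int[lebesgue_measure]_(r in `]0%R, +oo[) (w t r ^+ 4 * r ^+ 3)%:E)%E.
    apply: eq_integral => r; rewrite inE /= in_itv/= andbT => r0.
    by rewrite wE ?ltW// -normrX ger0_norm// exprn_even_ge0.
  rewrite (@not_bounded_below_by_cst _ _ (`|b| + 1) (e ^+ 4) (ccont_slice cf t0)) ?ltxx//.
  - by rewrite exprn_gt0.
  - move=> x x0; apply: mulr_ge0; first by rewrite exprn_even_ge0.
    by rewrite exprn_ge0// ltW.
  - move=> x bx; have b0 := normr_ge0 b; have bb := ler_norm b.
    have x1 : 1 <= x by lra.
    rewrite -[leLHS]mulr1 ler_pM ?exprn_ge0 ?(ltW e0) ?exprn_ege1//.
    have <- : `|w t x| ^+ 4 = w t x ^+ 4 by rewrite -normrX ger0_norm// exprn_even_ge0.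
    rewrite ler_pXn2r ?nnegrE ?(ltW e0)// leNgt; apply/negP => wx.
    by apply: H; exists x => //; lra.
have lam0 : 0 < lambda by case/andP: hlambda.
have loc_ge0 t a b : 0 < t -> 0 < a -> (0 <= local_energy u t a b)%E.
  move=> t0 a0; apply: integral_ge0 => r /=; rewrite in_itv/= => /andP[ar _].
  have r0 : 0 <= r by lra.
  by rewrite lee_fin mulr_ge0 ?exprn_ge0// !addr_ge0 ?sqr_ge0// divr_ge0 ?sqr_ge0.
have loc_le t a b : 0 < t -> 0 < a -> a <= b ->
    (forall r, a <= r <= b -> 0 < r /\ `|psi w t r| <= 1) ->
    (local_energy u t a b <= (12 * (energy w wt wr t b - energy w wt wr t a))%:E)%E.
  move=> t0 a0 ab ps1.
  have cp : ccont (fun t r => 12 * edens w wt wr t r) by rewrite /edens; ccont_tac.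
  have cd : ccont (fun t r => (wt t r ^+ 2 + wr t r ^+ 2) * r ^+ 3 + w t r ^+ 2 * r) by ccont_tac.
  have dE x : a <= x <= b -> has_der (fun x => 12 * energy w wt wr t x) x (12 * edens w wt wr t x).
    move=> /andP[ax _]; have hE : has_der (energy w wt wr t) x (edens w wt wr t x).
      by apply: (energy_dr cw Cw) => //; lra.
    by der; rewrite /=; ring.
  rewrite mulrBr -(integral_cc_eq ab (ccont_slice cp t0) dE) /local_energy.
  have -> : (\int[lebesgue_measure]_(r in `[a, b])
      ((dt u t r ^+ 2 + dr u t r ^+ 2 + `|u t r| ^+ 2 / r ^+ 2) * r ^+ 3)%:E =
      \int[lebesgue_measure]_(r in `[a, b])
      ((wt t r ^+ 2 + wr t r ^+ 2) * r ^+ 3 + w t r ^+ 2 * r)%:E)%E.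
    apply: eq_integral => r; rewrite inE /= in_itv/= => /ps1[r0 _]; congr EFin.
    rewrite dtE ?ltW// drE// wE ?ltW// real_normK ?num_real//.
    by field; rewrite gt_eqF.
  apply: ge0_le_integral => //=.
  - move=> r; rewrite in_itv/= => /ps1[r0 _]; rewrite lee_fin.
    by rewrite addr_ge0// mulr_ge0 ?addr_ge0 ?sqr_ge0 ?exprn_ge0 ?(ltW r0).
  - by apply/measurable_EFinP; apply: continuous_measurable_on => //; exact: (ccont_slice cd t0).
  - by apply/measurable_EFinP; apply: continuous_measurable_on => //; exact: (ccont_slice cp t0).
  - move=> r; rewrite in_itv/= => /ps1[r0 psi1]; rewrite lee_fin.
    apply: le_trans (density_le wt wr r0 psi1).
    by rewrite le_eqVlt; apply/orP; left; apply/eqP; field; rewrite gt_eqF.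
have main e : 0 < e -> \forall rho \near +oo,
    (0 <= limf_esup (fun t => local_energy u t (lambda * t) (t - rho)) (pinfty_nbhs R) <= e%:E)%E.
  (* The factor 12 is the constant of [density_le]. *)
  move=> e0; have e120 : 0 < e / 12 by rewrite divr_gt0.
  have [r0 Hr0] := energy_vanishes cw Cw Cwt Cwr weq C00 mass_le vanish hlambda e120.
  near=> rho; have /Hr0[T T0 HT] : r0 <= rho by near: rho; apply: nbhs_pinfty_ge; exact: num_real.
  apply/andP; split.
    by apply: limf_esup_pinfty_ge => t t0; exact: (loc_ge0 _ _ _ t0 (mulr_gt0 lam0 t0)).
  apply: (@limf_esup_pinfty_le _ _ T) => t Tt; have t0 : 0 < t by lra.
  have [lt|lt] := leP (lambda * t) (t - rho); last first.
    by rewrite /local_energy set_itv_ge ?integral_set0 ?lee_fin ?ltW// bnd_simp -ltNge.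
  have [Ele ps1] := HT t Tt lt.
  apply: le_trans (loc_le _ _ _ t0 (mulr_gt0 lam0 t0) lt ps1) _.
  by rewrite lee_fin; lra.
apply/fine_cvgP; split.
  apply: filterS (main 1 ltr01) => rho /andP[g0 g1].
  by rewrite ge0_fin_numE// (le_lt_trans g1)// ltry.
apply/cvgrPdist_le => e e0; near=> rho.
have /andP[g0 g1] : (0 <= limf_esup (fun t => local_energy u t (lambda * t) (t - rho)) (pinfty_nbhs R) <= e%:E)%E.
  by near: rho; exact: main.
rewrite sub0r normrN /= ger0_norm ?fine_ge0// -lee_fin fineK//.
by rewrite ge0_fin_numE// (le_lt_trans g1)// ltry.
Unshelve. all: by end_near. Qed.
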